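(* Let $A\in\mathbb{R}^{n,n}$ be a Schur matrix (i.e. $zI_n-A$ is nonsingular for all $z\in\mathbb{C}$ with $|z|\ge1$), and let $B_1\in\mathbb{R}^{n,k}$, $B_2\in\mathbb{R}^{n,q}$, $Q=Q'\in\mathbb{R}^{n+k+q,n+k+q}$. Let $\sigma(x,v,w)=[x;v;w]'Q[x;v;w]$, $B=[B_1,\ B_2]$, and for $|z|=1$ let $$\Pi(z)=\begin{bmatrix}(zI_n-A)^{-1}B\\ I_{k+q}\end{bmatrix}'Q\begin{bmatrix}(zI_n-A)^{-1}B\\ I_{k+q}\end{bmatrix}=\begin{bmatrix}\Pi_{11}(z)&\Pi_{12}(z)\\ \Pi_{21}(z)&\Pi_{22}(z)\end{bmatrix},\quad \Pi_{11}(z)\in\mathbb{C}^{k,k},\ \Pi_{22}(z)\in\mathbb{C}^{q,q}.$$ Assume there exist $\epsilon>0$ and $z_0\in\mathbb{T}=\{|z|=1\}$ such that $$\begin{bmatrix}\Pi_{11}(z)&\epsilon\Pi_{12}(z)\\ \epsilon\Pi_{21}(z)&-\Pi_{22}(z)\end{bmatrix}\ge0\ \ \forall z\in\mathbb{T},\qquad \Pi_{11}(z_0)>0,\quad \Pi_{22}(z_0)<0.$$ For $a\in\mathbb{R}^n$ define $g:\ell^2_k\times\ell^2_q\to\mathbb{R}$ by $g(v,w)=\sum_{t=0}^\infty\sigma(x(t),v(t),w(t))$, where $x(t+1)=Ax(t)+B_1v(t)+B_2w(t)$, $x(0)=a$. Then for every $a\in\mathbb{R}^n$: (a) the functions $g_v(w)=\inf_{v\in\ell^2_k}g(v,w)$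 and $g_w(v)=\sup_{w\in\ell^2_q}g(v,w)$ are (finite and) continuous in the standard norm topologies of $\ell^2_q$ and $\ell^2_k$ respectively; (b) $\inf_{v\in\ell^2_k}\sup_{w\in\ell^2_q}g(v,w)=\sup_{w\in\ell^2_q}\inf_{v\in\ell^2_k}g(v,w)$.
   Context: $\ell^2_m$ is the real Hilbert space of sequences $u:\mathbb{Z}_+\to\mathbb{R}^m$ with $\sum_{t\ge0}|u(t)|^2<\infty$, with the norm $(\sum|u(t)|^2)^{1/2}$. $M'$ denotes conjugate transpose; $[x;v;w]$ is the stacked column vector. For Hermitian matrices, $\ge0$, $>0$, $<0$ denote positive semidefinite, positive definite, negative definite. *)

(* Defs.v *)
From HB Require Import structures.
From mathcomp Require Import all_boot all_order all_algebra.
From mathcomp Require Import all_classical all_reals all_analysis.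
From mathcomp Require Import complex.
Set Implicit Arguments. Unset Strict Implicit. Unset Printing Implicit Defensive.
Import Order.TTheory GRing.Theory Num.Theory numFieldNormedType.Exports.
Local Open Scope classical_set_scope.
Local Open Scope ring_scope.

Section Defs.
Variable R : realType.

Definition cmx (m p : nat) (M : 'M[R]_(m, p)) : 'M[R[i]]_(m, p) :=
  map_mx (fun x => (x%:C)%C) M.

Definition ctr (m p : nat) (M : 'M[R[i]]_(m, p)) : 'M[R[i]]_(p, m) :=
  (map_mx (@conjc R) M)^T.

Definition qformC (m : nat) (M : 'M[R[i]]_m) (u : 'cV[R[i]]_m) : R[i] :=
  (ctr u *m M *m u) 0 0.

Definition psdC (m : nat) (M : 'M[R[i]]_m) : Prop :=
  forall u : 'cV[R[i]]_m, 0 <= qformC M u.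
Definition pdC (m : nat) (M : 'M[R[i]]_m) : Prop :=
  forall u : 'cV[R[i]]_m, u != 0 -> 0 < qformC M u.
Definition ndC (m : nat) (M : 'M[R[i]]_m) : Prop :=
  forall u : 'cV[R[i]]_m, u != 0 -> qformC M u < 0.

Definition schur (n : nat) (A : 'M[R]_n) : Prop :=
  forall z : R[i], 1 <= `|z| -> (z%:M - cmx A) \in unitmx.

Definition Pi (n k q : nat) (A : 'M[R]_n) (B1 : 'M[R]_(n, k)) (B2 : 'M[R]_(n, q))
  (Q : 'M[R]_(n + (k + q))) (z : R[i]) : 'M[R[i]]_(k + q) :=
  let M : 'M[R[i]]_(n + (k + q), k + q) :=
    col_mx (invmx (z%:M - cmx A) *m cmx (row_mx B1 B2)) 1%:M in
  ctr M *m cmx Q *m M.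

Definition Pi_eps (k q : nat) (eps : R) (P : 'M[R[i]]_(k + q)) : 'M[R[i]]_(k + q) :=
  block_mx (ulsubmx P) ((eps%:C)%C *: ursubmx P)
           ((eps%:C)%C *: dlsubmx P) (- drsubmx P).

Fixpoint traj (n k q : nat) (A : 'M[R]_n) (B1 : 'M[R]_(n, k)) (B2 : 'M[R]_(n, q))
  (a : 'cV[R]_n) (v : nat -> 'cV[R]_k) (w : nat -> 'cV[R]_q) (t : nat) : 'cV[R]_n :=
  match t with
  | 0 => a
  | t'.+1 => A *m traj A B1 B2 a v w t' + B1 *m v t' + B2 *m w t'
  end.

Definition sigma (n k q : nat) (Q : 'M[R]_(n + (k + q)))
  (x : 'cV[R]_n) (v : 'cV[R]_k) (w : 'cV[R]_q) : R :=
  let y := col_mx x (col_mx v w) in (y^T *m Q *m y) 0 0.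

Definition sqn (m : nat) (x : 'cV[R]_m) : R := (x^T *m x) 0 0.

Definition l2 (m : nat) : set (nat -> 'cV[R]_m) :=
  [set u : nat -> 'cV[R]_m | cvgn (series (fun t => sqn (u t)))].

Definition l2dist (m : nat) (u v : nat -> 'cV[R]_m) : R :=
  Num.sqrt (limn (series (fun t => sqn (u t - v t)))).

Definition gfun (n k q : nat) (A : 'M[R]_n) (B1 : 'M[R]_(n, k)) (B2 : 'M[R]_(n, q))
  (Q : 'M[R]_(n + (k + q))) (a : 'cV[R]_n)
  (v : nat -> 'cV[R]_k) (w : nat -> 'cV[R]_q) : R :=
  limn (series (fun t => sigma Q (traj A B1 B2 a v w t) (v t) (w t))).

Definition g_inf_v (n k q : nat) (A : 'M[R]_n) (B1 : 'M[R]_(n, k)) (B2 : 'M[R]_(n, q))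
  (Q : 'M[R]_(n + (k + q))) (a : 'cV[R]_n) (w : nat -> 'cV[R]_q) : \bar R :=
  ereal_inf [set ((gfun A B1 B2 Q a v w)%:E) | v in @l2 k].
Definition g_sup_w (n k q : nat) (A : 'M[R]_n) (B1 : 'M[R]_(n, k)) (B2 : 'M[R]_(n, q))
  (Q : 'M[R]_(n + (k + q))) (a : 'cV[R]_n) (v : nat -> 'cV[R]_k) : \bar R :=
  ereal_sup [set ((gfun A B1 B2 Q a v w)%:E) | w in @l2 q].

Definition l2_continuous (m : nat) (f : (nat -> 'cV[R]_m) -> R) : Prop :=
  forall u0, @l2 m u0 -> forall e : R, 0 < e ->
    exists2 d : R, 0 < d & forall u, @l2 m u -> l2dist u u0 < d -> `|f u - f u0| < e.

End Defs.
Arguments l2 {R} m _.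

(* Main.v *)
Require Import Defs.
From HB Require Import structures.
From mathcomp Require Import all_boot all_order all_algebra.
From mathcomp Require Import all_classical all_reals all_analysis.
From mathcomp Require Import cyclic separable cyclotomic.
From mathcomp Require Import complex ring lra.
Import Order.TTheory GRing.Theory Num.Theory numFieldNormedType.Exports.
Set Implicit Arguments.
Unset Strict Implicit.
Unset Printing Implicit Defensive.
Local Open Scope classical_set_scope.
Local Open Scope ring_scope.

(* The cost g(v, w) is a quadratic function of (v, w) whose quadratic part is
   qa v + 2 b(v, w) - qc w.  Parseval for long periodic inputs turns positivity of the
   weighted Popov matrix on the circle into eps^2 b^2 <= qa qc.  A nondegenerate point z0 makes
   the determinant of the (trigonometric polynomial) matrix Pi_11 nonzero, so Pi_11 dominates
   |prod_r (1 - r / z)|^2 up to a constant with all |r| <= 1; since 1 - r A is invertible for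
   such r, the linear part of the cost produced by the initial state is bounded by sqrt qa,
   and likewise for w with qc.  These three bounds give finite partial extrema, which are
   convex (resp. concave) and quadratically bounded, hence continuous.  For the minimax
   equality take w almost maximal for inf_v g and v almost minimal for g(., w): the three
   bounds show that (v, w) is almost a saddle point. *)

(** Positivity on the circle allows [Pi_11] and [Pi_22] to be singular at some frequencies, so [qa]
    and [qc] need not be coercive: minimizers may fail to exist in l2, and a bound of the linear
    part of the cost by the norm of the input would not help. This is why that bound has to be in
    terms of [qa], and why the minimax argument works with almost optimal inputs only. A factor 1 -
    r / z of the lower bound for [Pi_11] is the filter that sends v(t) to v(t) - r v(t-1); [qa]
    controls the energy of the filtered input even where it does not control that of the input. The
    contribution of the initial state a is first rewritten as a pairing of A^t a with the input
    itself; the filter can then be inserted at the price of replacing a by (1 - r A)^-1 a, a fixed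
    vector. Parseval is used only for finite sums over T-th roots of unity, so no integral over the
    circle occurs; in exchange, the periodic responses are not in l2 and must be compared with the
    true ones as T grows. *)

Section SquaredNorms.
Variable R : realType.
Local Notation C := R[i].

Lemma young (e a b : R) : 0 < e -> `|a * b| <= e * a ^+ 2 + e^-1 * b ^+ 2.
Proof.
move=> e0; have ei0 : 0 < e^-1 by rewrite invr_gt0.
have ee : e * e^-1 = 1 by rewrite divff ?gt_eqF.
have hp : 0 <= e^-1 * (e * a + b) ^+ 2 by rewrite mulr_ge0 ?sqr_ge0 // ltW.
have hm : 0 <= e^-1 * (e * a - b) ^+ 2 by rewrite mulr_ge0 ?sqr_ge0 // ltW.
have ha : 0 <= e * a ^+ 2 by rewrite mulr_ge0 ?sqr_ge0 // ltW.
have hb : 0 <= e^-1 * b ^+ 2 by rewrite mulr_ge0 ?sqr_ge0 // ltW.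
have E1 : e^-1 * (e * a + b) ^+ 2 = (e * e^-1) * e * a ^+ 2 + 2 * (e * e^-1) * (a * b) + e^-1 * b ^+ 2 by ring.
have E2 : e^-1 * (e * a - b) ^+ 2 = (e * e^-1) * e * a ^+ 2 - 2 * (e * e^-1) * (a * b) + e^-1 * b ^+ 2 by ring.
rewrite E1 ee in hp; rewrite E2 ee in hm; rewrite ler_norml; apply/andP; split; lra.
Qed.

Lemma sqn_sum m (x : 'cV[R]_m) : sqn x = \sum_i x i 0 ^+ 2.
Proof. by rewrite /sqn mxE; apply: eq_bigr => i _; rewrite mxE expr2. Qed.

Lemma sqn_ge0 m (x : 'cV[R]_m) : 0 <= sqn x.
Proof. by rewrite sqn_sum; apply: sumr_ge0 => i _; exact: sqr_ge0. Qed.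

Lemma sqn0 m : sqn (0 : 'cV[R]_m) = 0.
Proof. by rewrite /sqn mulmx0 mxE. Qed.

Lemma sqn_eq0 m (x : 'cV[R]_m) : sqn x = 0 -> x = 0.
Proof.
rewrite sqn_sum => /eqP; rewrite psumr_eq0; last by move=> i _; exact: sqr_ge0.
move=> /allP h; apply/matrixP => i j; rewrite ord1 mxE.
by have := h i (mem_index_enum _); rewrite /= sqrf_eq0 => /eqP.
Qed.

Lemma sqnZ m (s : R) (x : 'cV[R]_m) : sqn (s *: x) = s ^+ 2 * sqn x.
Proof. by rewrite !sqn_sum mulr_sumr; apply: eq_bigr => i _; rewrite mxE exprMn. Qed.

Lemma sqnD_le m (x y : 'cV[R]_m) : sqn (x + y) <= 2 * sqn x + 2 * sqn y.
Proof.
rewrite !sqn_sum !mulr_sumr -big_split; apply: ler_sum => i _ /=; rewrite !mxE.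
have := sqr_ge0 (x i 0 - y i 0); nra.
Qed.

Definition bil m p (M : 'M[R]_(m, p)) (x : 'cV[R]_m) (y : 'cV[R]_p) : R :=
  (x^T *m M *m y) 0 0.

Lemma bilE m p (M : 'M[R]_(m, p)) x y :
  bil M x y = \sum_i \sum_j x i 0 * M i j * y j 0.
Proof.
rewrite /bil mxE exchange_big /=; apply: eq_bigr => j _.
by rewrite mxE mulr_suml; apply: eq_bigr => i _; rewrite mxE.
Qed.

Lemma bilDl m p (M : 'M[R]_(m, p)) x1 x2 y : bil M (x1 + x2) y = bil M x1 y + bil M x2 y.
Proof. by rewrite /bil linearD !mulmxDl mxE. Qed.
Lemma bilDr m p (M : 'M[R]_(m, p)) x y1 y2 : bil M x (y1 + y2) = bil M x y1 + bil M x y2.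
Proof. by rewrite /bil mulmxDr mxE. Qed.
Lemma bilZl m p (M : 'M[R]_(m, p)) s x y : bil M (s *: x) y = s * bil M x y.
Proof. by rewrite /bil linearZ /= -!scalemxAl mxE. Qed.
Lemma bilZr m p (M : 'M[R]_(m, p)) s x y : bil M x (s *: y) = s * bil M x y.
Proof. by rewrite /bil -!scalemxAr mxE. Qed.
Lemma bil_sym m (M : 'M[R]_m) x y : M^T = M -> bil M x y = bil M y x.
Proof.
move=> sM; have -> : bil M x y = ((x^T *m M *m y)^T) 0 0 by rewrite mxE.
by rewrite !trmx_mul trmxK sM mulmxA.
Qed.

Lemma bilD m p (M N : 'M[R]_(m, p)) x y : bil (M + N) x y = bil M x y + bil N x y.
Proof. by rewrite /bil mulmxDr mulmxDl mxE. Qed.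

Lemma bilN m p (M : 'M[R]_(m, p)) x y : bil (- M) x y = - bil M x y.
Proof. by rewrite /bil mulmxN mulNmx mxE. Qed.

(** The entrywise 1-norm, raised by one so that it can be divided by even when the matrix is
    zero. *)
Definition mxabs m p (M : 'M[R]_(m, p)) : R := 1 + \sum_i \sum_j `|M i j|.

Lemma mxabs_gt0 m p (M : 'M[R]_(m, p)) : 0 < mxabs M.
Proof.
rewrite /mxabs ltr_pwDl// sumr_ge0// => i _; apply: sumr_ge0 => j _; exact: normr_ge0.
Qed.

Lemma sqn_ge_coord m (x : 'cV[R]_m) i : x i 0 ^+ 2 <= sqn x.
Proof.
rewrite sqn_sum (bigD1 i) //= lerDl; apply: sumr_ge0 => j _; exact: sqr_ge0.
Qed.

Lemma bil_le m p (M : 'M[R]_(m, p)) x y (e : R) : 0 < e ->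
  `|bil M x y| <= mxabs M * (e * sqn x + e^-1 * sqn y).
Proof.
move=> e0; have ei0 : 0 < e^-1 by rewrite invr_gt0.
rewrite bilE /mxabs mulrDl mul1r.
have h0 : 0 <= e * sqn x + e^-1 * sqn y.
  by rewrite addr_ge0 // mulr_ge0 ?sqn_ge0 // ltW.
rewrite -[leLHS]add0r lerD // mulr_suml; apply: (le_trans (ler_norm_sum _ _ _)).
apply: ler_sum => i _; rewrite mulr_suml; apply: (le_trans (ler_norm_sum _ _ _)).
apply: ler_sum => j _.
have -> : x i 0 * M i j * y j 0 = M i j * (x i 0 * y j 0) by ring.
rewrite normrM ler_wpM2l //.
have hx := ler_wpM2l (ltW e0) (sqn_ge_coord x i).
have hy := ler_wpM2l (ltW ei0) (sqn_ge_coord y j).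
have := lerD hx hy; apply: le_trans.
exact: young.
Qed.

Definition csq (z : C) : R := complex.Re z ^+ 2 + complex.Im z ^+ 2.

Lemma csqE (z : C) : (csq z)%:C%C = `|z| ^+ 2.
Proof. exact: add_Re2_Im2. Qed.

Lemma csq_ge0 z : 0 <= csq z.
Proof. by rewrite addr_ge0 ?sqr_ge0. Qed.

Lemma csq_eq0 z : csq z = 0 -> z = 0.
Proof.
by move=> h; have /eqP := csqE z; rewrite h eq_sym expf_eq0 /= normr_eq0 => /eqP.
Qed.

Lemma csqM z1 z2 : csq (z1 * z2) = csq z1 * csq z2.
Proof. by apply: complexI; rewrite rmorphM /= !csqE normrM exprMn. Qed.

Lemma csq1P z : (csq z = 1) <-> (`|z| = 1).
Proof.
split=> [h|h]; last by apply: complexI; rewrite csqE h expr1n.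
have : `|z| ^+ 2 = 1 by rewrite -csqE h.
by move/eqP; rewrite sqrp_eq1 // => /eqP.
Qed.

Lemma csq_lt1P z : (csq z < 1) = (`|z| < 1).
Proof. by rewrite -ltcR csqE expr_lt1. Qed.

(** The weight [d] is free so that the factor of the first term can be taken as close to 1 as a
    contraction requires. *)
Lemma csqD_le (d : R) z1 z2 : 0 < d ->
  csq (z1 + z2) <= (1 + d) * csq z1 + (1 + d^-1) * csq z2.
Proof.
case: z1 z2 => [a b] [c f] d0; rewrite /csq /=.
have d20 : 0 < d / 2 by lra.
have e1 : (d / 2)^-1 = 2 * d^-1 by rewrite invfM invrK mulrC.
have di : 0 < d^-1 by rewrite invr_gt0.
have sq (x y : R) : (x + y) ^+ 2 <= (1 + d) * x ^+ 2 + (1 + d^-1) * y ^+ 2.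
  have dd : d * d^-1 = 1 by rewrite divff ?gt_eqF.
  have hm : 0 <= d^-1 * (d * x - y) ^+ 2 by rewrite mulr_ge0 ?sqr_ge0 // ltW.
  have E2 : d^-1 * (d * x - y) ^+ 2 =
    (d * d^-1) * d * x ^+ 2 - 2 * (d * d^-1) * (x * y) + d^-1 * y ^+ 2 by ring.
  rewrite E2 dd in hm; nra.
by have := lerD (sq a c) (sq b f); lra.
Qed.

Definition nsqC m (x : 'cV[C]_m) : R := \sum_i csq (x i 0).

Lemma nsqC_ge0 m (x : 'cV[C]_m) : 0 <= nsqC x.
Proof. by apply: sumr_ge0 => i _; exact: csq_ge0. Qed.

Lemma nsqC_cmx m (x : 'cV[R]_m) : nsqC (cmx x) = sqn x.
Proof.
rewrite sqn_sum; apply: eq_bigr => i _.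
by rewrite /cmx mxE /csq /= expr0n addr0.
Qed.

Lemma nsqCZ m (s : C) (x : 'cV[C]_m) : nsqC (s *: x) = csq s * nsqC x.
Proof. by rewrite /nsqC mulr_sumr; apply: eq_bigr => i _; rewrite mxE csqM. Qed.

Lemma nsqCD_le m (d : R) (x y : 'cV[C]_m) : 0 < d ->
  nsqC (x + y) <= (1 + d) * nsqC x + (1 + d^-1) * nsqC y.
Proof.
move=> d0; rewrite /nsqC !mulr_sumr -big_split; apply: ler_sum => i _ /=.
by rewrite mxE; exact: csqD_le.
Qed.

Lemma nsqC0 m : nsqC (0 : 'cV[C]_m) = 0.
Proof. by rewrite /nsqC big1 // => i _; rewrite mxE /csq /= expr0n addr0. Qed.

Lemma csq_sum_le (I : Type) (r : seq I) (F : I -> C) :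
  csq (\sum_(i <- r) F i) <= (2 ^ size r)%:R * \sum_(i <- r) csq (F i).
Proof.
elim: r => [|i r ih]; first by rewrite !big_nil /csq /= expr0n addr0 mulr0.
rewrite !big_cons; have := @csqD_le 1 (F i) (\sum_(j <- r) F j) ltr01.
rewrite invr1 => /le_trans; apply; rewrite [leRHS]mulrDr; apply: lerD.
  by rewrite ler_wpM2r ?csq_ge0 // (ler_nat R 2) /= expnS leq_pmulr // expn_gt0.
rewrite /= expnS natrM -mulrA ler_wpM2l //; lra.
Qed.

Lemma nsqC_mulmx_le p m (M : 'M[C]_(p, m)) (x : 'cV[C]_m) :
  nsqC (M *m x) <= (\sum_i (2 ^ size (index_enum 'I_m))%:R * \sum_j csq (M i j)) * nsqC x.
Proof.
rewrite mulr_suml; apply: ler_sum => i _; rewrite mxE; apply: (le_trans (csq_sum_le _ _)).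
rewrite -mulrA ler_wpM2l // mulr_suml; apply: ler_sum => j _; rewrite csqM.
rewrite ler_wpM2l ?csq_ge0 // /nsqC (bigD1 j) //= lerDl sumr_ge0 // => l _; exact: csq_ge0.
Qed.

Lemma nsqC_mulmx p m (M : 'M[C]_(p, m)) :
  {c : R | 0 < c & forall x : 'cV[C]_m, nsqC (M *m x) <= c * nsqC x}.
Proof.
exists (1 + \sum_i (2 ^ size (index_enum 'I_m))%:R * \sum_j csq (M i j)).
  by rewrite ltr_pwDl // sumr_ge0 // => i _; rewrite mulr_ge0 // sumr_ge0 // => j _; exact: csq_ge0.
by move=> x; rewrite mulrDl mul1r ler_wpDl ?nsqC_ge0 // nsqC_mulmx_le.
Qed.

Lemma cmxM p m l (M : 'M[R]_(p, m)) (N : 'M[R]_(m, l)) : cmx (M *m N) = cmx M *m cmx N.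
Proof. exact: map_mxM. Qed.

Lemma cmxD p m (M N : 'M[R]_(p, m)) : cmx (M + N) = cmx M + cmx N.
Proof. exact: map_mxD. Qed.

Lemma sqn_mulmx p m (M : 'M[R]_(p, m)) :
  {c : R | 0 < c & forall x : 'cV[R]_m, sqn (M *m x) <= c * sqn x}.
Proof.
have [c c0 h] := nsqC_mulmx (cmx M); exists c => // x.
by have := h (cmx x); rewrite -cmxM !nsqC_cmx.
Qed.

End SquaredNorms.

(** * Energy estimates for Schur matrices *)

Section Energy.
Variable R : realType.
Local Notation C := R[i].

(** The head of the list stands rightmost, hence acts first on a vector; this matches the
    substitution y = (A - r) x of the induction below. *)
Definition shift_prod n (A : 'M[C]_n) (rs : seq C) : 'M[C]_n :=
  foldr (fun r M => M *m (A - r%:M)) 1%:M rs.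

(* One root r of modulus < 1 is peeled off at a time: with y = (A - r) x,
   x (t + 1) = r x t + (y t + f t) is a scalar contraction driven by y + f. *)
Lemma energy_shift_prod n (A : 'M[C]_n) (rs : seq C) :
  all (fun r => `|r| < 1) rs ->
  {c : R | 0 < c & forall (x f : nat -> 'cV[C]_n),
    (forall t, x t.+1 = A *m x t + f t) -> forall T,
    \sum_(t < T) nsqC (x t) <=
      c * (nsqC (x 0%N) + \sum_(t < T) nsqC (f t)
           + \sum_(t < T) nsqC (shift_prod A rs *m x t))}.
Proof.
elim: rs => [_|r rs ih /= /andP[r1 /ih{ih}[c c0 hc]]].
  exists 1 => // x f _ T; rewrite mul1r /=.
  under [X in _ <= _ + X]eq_bigr do rewrite mul1mx.
  by rewrite lerDr addr_ge0 ?nsqC_ge0 // sumr_ge0 // => t _; exact: nsqC_ge0.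
have [d d0 hd] := nsqC_mulmx (A - r%:M).
set s := csq r; have s0 : 0 <= s := csq_ge0 _.
have s1 : s < 1 by rewrite csq_lt1P.
clear r1.
(* Since s = 1 - 2e, one has (1 + e) s <= 1 - e: splitting the square with weight [e] still leaves a
   contraction, and [g] is the factor that falls on the driving term. *)
set e := (1 - s) / 2; have e0 : 0 < e by rewrite /e; lra.
set g := 1 + e^-1; have ei : 0 < e^-1 by rewrite invr_gt0.
have g0 : 0 < g by rewrite /g; lra.
have h1 : e^-1 * e = 1 by rewrite mulVf ?gt_eqF.
exists (e^-1 * (1 + 2 * g * (c * (d + 1) + 1))).
  rewrite mulr_gt0 // ltr_pwDl // mulr_ge0 ?mulr_ge0 ?addr_ge0 ?mulr_ge0 //; lra.
move=> x f xf T.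
pose y t := (A - r%:M) *m x t.
have yf t : y t.+1 = A *m y t + (A - r%:M) *m f t.
  rewrite /y xf mulmxDr; congr (_ + _); rewrite !mulmxA mulmxBl mulmxBr.
  by rewrite scalar_mxC.
set X := \sum_(t < T) nsqC (x t); set F := \sum_(t < T) nsqC (f t).
set Z := \sum_(t < T) nsqC (_ *m x t).
pose Y := \sum_(t < T) nsqC (y t).
pose G := \sum_(t < T) nsqC ((A - r%:M) *m f t).
have hY : Y <= c * (nsqC (y 0%N) + G + Z).
  rewrite /Z (eq_bigr (fun t : 'I_T => nsqC (shift_prod A rs *m y t))) => [|t _].
    exact: hc yf T.
  by rewrite /y mulmxA.
have F0 : 0 <= F by apply: sumr_ge0 => t _; exact: nsqC_ge0.
have X0 : 0 <= X by apply: sumr_ge0 => t _; exact: nsqC_ge0.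
have Z0 : 0 <= Z by apply: sumr_ge0 => t _; exact: nsqC_ge0.
have x00 : 0 <= nsqC (x 0%N) := nsqC_ge0 _.
have hG : G <= d * F by rewrite /G mulr_sumr; apply: ler_sum => t _; exact: hd.
have hy0 : nsqC (y 0%N) <= d * nsqC (x 0%N) by exact: hd.
have hY' : Y <= c * (d * nsqC (x 0%N) + d * F + Z).
  by apply: (le_trans hY); rewrite ler_wpM2l ?(ltW c0) // lerD2r lerD.
have step t : nsqC (x t.+1) <= (1 - e) * nsqC (x t) + 2 * g * (nsqC (y t) + nsqC (f t)).
  have -> : x t.+1 = r *: x t + (y t + f t).
    by rewrite xf /y mulmxBl mul_scalar_mx addrA addrCA subrr addr0.
  apply: (le_trans (nsqCD_le _ _ e0)); rewrite nsqCZ -/s -/g lerD //.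
    rewrite mulrA ler_wpM2r ?nsqC_ge0 //; rewrite /e; nra.
  have := @nsqCD_le R n 1 (y t) (f t) ltr01; rewrite invr1 => hh.
  rewrite (mulrC 2) -mulrA ler_wpM2l ?(ltW g0) //; lra.
have hX : X <= nsqC (x 0%N) + (1 - e) * X + 2 * g * (Y + F).
  rewrite -addrA (_ : (1 - e) * X + 2 * g * (Y + F) = \sum_(t < T)
      ((1 - e) * nsqC (x t) + 2 * g * (nsqC (y t) + nsqC (f t)))); last first.
    by rewrite big_split /= -!mulr_sumr big_split.
  apply: (@le_trans _ _ (\sum_(t < T.+1) nsqC (x t))).
    by rewrite big_ord_recr /= lerDl nsqC_ge0.
  by rewrite big_ord_recl /= lerD2l; apply: ler_sum => t _; exact: step.
have hX' : e * X <= nsqC (x 0%N) + 2 * g * (Y + F) by lra.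
have : X <= e^-1 * (nsqC (x 0%N) + 2 * g * (Y + F)).
  by rewrite -(ler_pM2l e0) mulrA mulfV ?gt_eqF // mul1r.
move=> /le_trans; apply; rewrite -[leRHS]mulrA; apply: ler_wpM2l; first exact: (ltW ei).
rewrite [leRHS]mulrDl mul1r.
have hZ : nsqC (x 0%N) <= nsqC (x 0%N) + F + Z by lra.
apply: lerD hZ _; rewrite -!mulrA; apply: ler_wpM2l => //; apply: ler_wpM2l; first lra.
rewrite mulrDl mul1r; apply: lerD; last lra.
apply: (le_trans hY'); rewrite -mulrA; apply: ler_wpM2l; first lra.
nra.
Qed.

(** Every root of the characteristic polynomial is an eigenvalue, so it has modulus < 1; by
    Cayley-Hamilton the product of all the factors A - r is zero, and the last sum in
    [energy_shift_prod] disappears. *)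
Lemma schur_energyC n (A : 'M[R]_n) : schur A ->
  {c : R | 0 < c & forall (x f : nat -> 'cV[C]_n),
    (forall t, x t.+1 = cmx A *m x t + f t) -> forall T,
    \sum_(t < T) nsqC (x t) <= c * (nsqC (x 0%N) + \sum_(t < T) nsqC (f t))}.
Proof.
case: n A => [|n] A sA.
  exists 1 => // x f _ T; rewrite mul1r big1 => [|t _]; last by rewrite (flatmx0 (x t)) nsqC0.
  by rewrite addr_ge0 ?nsqC_ge0 // sumr_ge0 // => t _; exact: nsqC_ge0.
have [rs Dp] := closed_field_poly_normal (char_poly (cmx A)).
rewrite (monicP (char_poly_monic _)) scale1r in Dp.
have rs1 : all (fun r => `|r| < 1) rs.
  apply/allP => r rrs; have : root (char_poly (cmx A)) r by rewrite Dp root_prod_XsubC.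
  rewrite -eigenvalue_root_char => /eigenvalueP[v vA v0].
  rewrite real_ltNge ?normr_real //; apply/negP => /sA uA.
  have : v *m (r%:M - cmx A) = 0 by rewrite mulmxBr vA mul_mx_scalar subrr.
  by move/(congr1 (mulmx^~ (invmx (r%:M - cmx A)))); rewrite mulmxK // mul0mx; apply/eqP.
have [c c0 hc] := energy_shift_prod (cmx A) rs1; exists c => // x f xf T.
have -> : \sum_(t < T) nsqC (f t) = \sum_(t < T) nsqC (f t) +
    \sum_(t < T) nsqC (shift_prod (cmx A) rs *m x t).
  rewrite [X in _ = _ + X]big1 ?addr0 // => t _; rewrite (_ : shift_prod _ _ = 0) ?mul0mx ?nsqC0 //.
  have := Cayley_Hamilton (cmx A); rewrite Dp => <-.
  elim: rs {rs1 c c0 hc Dp} => [|r rs ih]; first by rewrite big_nil rmorph1.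
  by rewrite big_cons /= ih mulrC rmorphM rmorphB /= horner_mx_X horner_mx_C.
by rewrite addrA; exact: hc.
Qed.

Lemma schur_energy n (A : 'M[R]_n) : schur A ->
  {c : R | 0 < c & forall (x f : nat -> 'cV[R]_n),
    (forall t, x t.+1 = A *m x t + f t) -> forall T,
    \sum_(t < T) sqn (x t) <= c * (sqn (x 0%N) + \sum_(t < T) sqn (f t))}.
Proof.
move=> /schur_energyC[c c0 h]; exists c => // x f xf T.
have e t : cmx (x t.+1) = cmx A *m cmx (x t) + cmx (f t) by rewrite xf cmxD cmxM.
have := h (fun t => cmx (x t)) (fun t => cmx (f t)) e T; rewrite /= nsqC_cmx.
rewrite (eq_bigr (fun t : 'I_T => sqn (x t)) (fun t _ => nsqC_cmx (x t))).
by rewrite (eq_bigr (fun t : 'I_T => sqn (f t)) (fun t _ => nsqC_cmx (f t))).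
Qed.

Fixpoint expmx n (A : 'M[R]_n) t : 'M[R]_n :=
  if t is t'.+1 then A *m expmx A t' else 1%:M.

Lemma expmxD n (A : 'M[R]_n) s t : expmx A (s + t) = expmx A s *m expmx A t.
Proof. by elim: s => [|s ih] /=; rewrite ?mul1mx // ih mulmxA. Qed.

Lemma expmxSr n (A : 'M[R]_n) t : expmx A t.+1 = expmx A t *m A.
Proof. by rewrite -addn1 expmxD /= mulmx1. Qed.

Lemma expmx_energy n (A : 'M[R]_n) : schur A ->
  {c : R | 0 < c & forall x T, \sum_(t < T) sqn (expmx A t *m x) <= c * sqn x}.
Proof.
move=> /schur_energy[c c0 h]; exists c => // x T.
have e t : expmx A t.+1 *m x = A *m (expmx A t *m x) + 0 by rewrite addr0 mulmxA.
have := h (fun t => expmx A t *m x) (fun=> 0) e T; rewrite /= mul1mx.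
by rewrite [X in _ + X]big1 ?addr0 // => t _; rewrite sqn0.
Qed.

(** Each of the T terms A^T x = A^(T-t) (A^t x) is bounded by the energy estimate started at A^t x;
    adding them up and using the estimate once more gives c^2. This 1/T decay replaces any estimate
    of the spectral radius. *)
Lemma expmx_small n (A : 'M[R]_n) : schur A ->
  {c : R | 0 < c & forall x T, T%:R * sqn (expmx A T *m x) <= c * sqn x}.
Proof.
move=> /expmx_energy[c c0 h]; exists (c * c); rewrite ?mulr_gt0 // => x T.
have h1 : \sum_(t < T) sqn (expmx A T *m x) <= \sum_(t < T) c * sqn (expmx A t *m x).
  apply: ler_sum => t _; have := h (expmx A t *m x) (T - t).+1.
  rewrite big_ord_recr /= mulmxA -expmxD subnK ?(ltnW (ltn_ord t)) // => /(le_trans _); apply.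
  by rewrite lerDr sumr_ge0 // => i _; exact: sqn_ge0.
rewrite sumr_const card_ord mulr_natl in h1 *; apply: (le_trans h1).
by rewrite -mulr_sumr -mulrA ler_wpM2l // ltW.
Qed.

End Energy.

(** * Extrema of bounded real functions in the extended reals *)

Section ExtendedExtrema.
Variables (R : realType) (T : Type).

Lemma ereal_sup_bounded (P : set T) (f : T -> R) (w0 : T) (M : R) :
  P w0 -> (forall w, P w -> f w <= M) ->
  exists s : R, [/\ ereal_sup [set (f w)%:E | w in P] = s%:E,
    forall w, P w -> f w <= s & forall M', (forall w, P w -> f w <= M') -> s <= M'].
Proof.
move=> P0 fM; set S := [set _ | _ in _]; have ub (M' : R) :
    (forall w, P w -> f w <= M') -> (ereal_sup S <= M'%:E)%E.
  by move=> h; apply: ge_ereal_sup => _ [w Pw <-]; rewrite lee_fin h.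
have lb w : P w -> ((f w)%:E <= ereal_sup S)%E by move=> Pw; apply: ereal_sup_ubound; exists w.
have fs : ereal_sup S \is a fin_num.
  by rewrite fin_numElt (lt_le_trans (ltNyr _) (lb _ P0)) (le_lt_trans (ub _ fM) (ltry _)).
exists (fine (ereal_sup S)); split; first by rewrite fineK.
- by move=> w /lb; rewrite -{1}(fineK fs) lee_fin.
- by move=> M' /ub; rewrite -{1}(fineK fs) lee_fin.
Qed.

Lemma ereal_inf_bounded (P : set T) (f : T -> R) (w0 : T) (M : R) :
  P w0 -> (forall w, P w -> M <= f w) ->
  exists s : R, [/\ ereal_inf [set (f w)%:E | w in P] = s%:E,
    forall w, P w -> s <= f w & forall M', (forall w, P w -> M' <= f w) -> M' <= s].
Proof.
move=> P0 fM; have h w : P w -> (\- f) w <= - M by move=> Pw; rewrite lerN2 fM.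
have [s [sE s1 s2]] := ereal_sup_bounded P0 h; exists (- s); split.
- rewrite /ereal_inf EFinN -sE; congr (- ereal_sup _)%E.
  by rewrite image_comp; apply: eq_imagel => w _ /=; rewrite EFinN.
- by move=> w /s1; rewrite lerNl.
- by move=> M' h'; rewrite lerNr; apply: s2 => w /h'; rewrite lerN2.
Qed.

End ExtendedExtrema.

(** * Continuity of convex functions with a quadratic upper bound *)

Section ConvexContinuity.
Variables (R : realType) (X : lmodType R) (P : set X) (N : X -> R) (f : X -> R).
Hypothesis PD : forall s u v, P u -> P v -> P (u + s *: v).
Hypothesis NZ : forall s u, P u -> N (s *: u) = s ^+ 2 * N u.
Hypothesis ND : forall u v, P u -> P v -> N (u + v) <= 2 * N u + 2 * N v.
Hypothesis N_ge0 : forall u, P u -> 0 <= N u.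
Hypothesis f_convex : forall s u v, P u -> P v -> 0 <= s -> s <= 1 ->
  f (u + s *: (v - u)) <= (1 - s) * f u + s * f v.
Variables c1 c2 : R.
Hypothesis c2_ge0 : 0 <= c2.
Hypothesis f_le : forall u, P u -> f u <= c1 + c2 * N u.

(** A convex function that is bounded above near a point is continuous there: the upper bound [B] at
    the two dilated points u0 + u/t and u0 - u/t controls f(u0 + u) from both sides. [N] plays the
    role of a squared norm. *)
Lemma convex_continuous u0 : P u0 -> forall e : R, 0 < e ->
  exists2 d : R, 0 < d & forall u, P u -> Num.sqrt (N (u - u0)) < d -> `|f u - f u0| < e.
Proof.
move=> Pu0 e e0; pose B := c1 + c2 * (2 * N u0 + 2).
have [D D0 BD] : exists2 D, 0 < D & B - f u0 <= D.
  exists (`|B - f u0| + 1); first by rewrite ltr_wpDl.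
  by rewrite ler_wpDr // ler_norm.
have [t [t0 t1 tD]] : exists t, [/\ 0 < t, t <= 1 & t * D < e].
  have eD : 0 < e + D by lra.
  exists (e / (e + D)); split; first by rewrite divr_gt0.
    by rewrite ler_pdivrMr // mul1r; lra.
  by rewrite mulrAC ltr_pdivrMr //; nra.
have tinv : t * t^-1 = 1 by rewrite divff ?gt_eqF.
(* The same [t] is the radius and the weight of the convex combinations: N(u) < t^2 keeps N(u/t)
   below 1, while t D < e makes the resulting variation small. *)
exists t => // u Pu; have PB : P (u - u0) by rewrite -scaleN1r; exact: PD.
have -> : u = u0 + (u - u0) by rewrite addrC subrK.
move: (u - u0) PB => {Pu}{}u Pu; rewrite addrAC subrr add0r => sN.
have Nu : N u < t ^+ 2.
  by rewrite -[N u]sqr_sqrtr ?N_ge0 // ltr_pXn2r // nnegrE ?sqrtr_ge0 // ltW.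
have PZ s : P (s *: u).
  by have := PD (s - 1) Pu Pu; rewrite scalerBl scale1r addrC subrK.
have bound s : s ^+ 2 = 1 -> f (u0 + (s / t) *: u) <= B.
  move=> s2; apply: (le_trans (f_le (PD _ Pu0 Pu))); rewrite /B lerD2l ler_wpM2l //.
  apply: (le_trans (ND Pu0 (PZ _))); rewrite lerD2l NZ // expr_div_n s2.
  have : 1 / t ^+ 2 * N u <= 1; last lra.
  by rewrite mul1r mulrC ler_pdivrMr ?exprn_gt0 // mul1r ltW.
have hp : f (u0 + u) <= (1 - t) * f u0 + t * f (u0 + (1 / t) *: u).
  have := f_convex Pu0 (PD (1 / t) Pu0 Pu) (ltW t0) t1.
  by rewrite [u0 + _ *: u - u0]addrAC subrr add0r scalerA div1r tinv scale1r.
have t1p : 0 < 1 + t by lra.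
(* Here u0 itself is the convex combination, of u0 + u and u0 - u/t with weights 1/(1+t) and
   t/(1+t); this gives the lower bound on f(u0 + u). *)
have hm : f u0 <= (1 - t / (1 + t)) * f (u0 + u) + t / (1 + t) * f (u0 + (-1 / t) *: u).
  have s0 : 0 <= t / (1 + t) by rewrite divr_ge0 // ltW.
  have s1 : t / (1 + t) <= 1 by rewrite ler_pdivrMr // mul1r; lra.
  have := f_convex (PD 1 Pu0 Pu) (PD (-1 / t) Pu0 Pu) s0 s1.
  rewrite scale1r opprD addrACA subrr add0r -[X in _ - X]scale1r -scalerBl scalerA.
  rewrite -addrA -[X in X + _ *: u]scale1r -scalerDl.
  have -> : 1 + t / (1 + t) * (-1 / t - 1) = 0.
    by field; rewrite !gt_eqF //= .
  by rewrite scale0r addr0.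
have b1 := bound 1 (expr1n _ _).
have b2 := bound (-1) (etrans (sqrrN 1) (expr1n _ _)).
have hm' : (1 + t) * f u0 <= f (u0 + u) + t * f (u0 + (-1 / t) *: u).
  have := ler_wpM2l (ltW t1p) hm.
  have -> : (1 + t) * ((1 - t / (1 + t)) * f (u0 + u) + t / (1 + t) * f (u0 + (-1 / t) *: u))
     = f (u0 + u) + t * f (u0 + (-1 / t) *: u) by field; rewrite gt_eqF.
  by [].
have tb1 := ler_wpM2l (ltW t0) b1; have tb2 := ler_wpM2l (ltW t0) b2.
have tB := ler_wpM2l (ltW t0) BD.
rewrite ltr_norml; apply/andP; split; nra.
Qed.

End ConvexContinuity.

(** * Abstract quadratic games: finite and continuous suprema *)

Section Minimax.
Variables (R : realType) (X Y : lmodType R) (P : set X) (S : set Y).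
Variables (g : X -> Y -> R) (Dv : X -> Y -> X -> R) (Dw : X -> Y -> Y -> R).
Variables (qa : X -> R) (b : X -> Y -> R) (qc : Y -> R) (eps c : R).

(** The last three fields are discriminant conditions written as nonnegative polynomials in the
    scalars: eps^2 b^2 <= qa qc, Dv^2 <= 4 c qa and Dw^2 <= 4 c qc, the linear parts being taken at
    the origin. In this form no square root appears and vanishing [qa] or [qc] needs no separate
    case. *)
Definition quadratic_saddle :=
  [/\ forall v h w j s r, P v -> P h -> S w -> S j ->
        g (v + s *: h) (w + r *: j) = g v w + s * Dv v w h + r * Dw v w j
          + s ^+ 2 * qa h + 2 * (s * r) * b h j - r ^+ 2 * qc j,
      forall h j s r, P h -> S j ->
        0 <= s ^+ 2 * qa h + 2 * eps * (s * r) * b h j + r ^+ 2 * qc j,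
      forall h s, P h -> 0 <= c + s * Dv 0 0 h + s ^+ 2 * qa h &
      forall j r, S j -> 0 <= c - r * Dw 0 0 j + r ^+ 2 * qc j].

Definition lin_closed (Z : lmodType R) (Q : set Z) :=
  Q 0 /\ forall s u v, Q u -> Q v -> Q (u + s *: v).

Hypothesis H : quadratic_saddle.
Hypotheses (PP : lin_closed P) (SS : lin_closed S).
Hypothesis eps0 : 0 < eps.

Let H1 := let: And4 h _ _ _ := H in h.
Let H2 := let: And4 _ h _ _ := H in h.
Let H3 := let: And4 _ _ h _ := H in h.
Let H4 := let: And4 _ _ _ h := H in h.

Let qa_ge0 h : P h -> 0 <= qa h.
Proof.
by move=> Ph; have := H2 1 0 Ph SS.1; rewrite expr1n expr0n mul1r !mulr0 !mul0r !addr0.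
Qed.

Lemma saddle_le v w : P v -> S w ->
  g v w <= g 0 0 + 3 * c + (2 + 2 * eps^-2) * qa v.
Proof.
move=> Pv Sw; have := H1 1 1 PP.1 Pv SS.1 Sw.
rewrite !scale1r !add0r !expr1n !mul1r => ->.
have h4 := H4 (1 / 2) Sw; have h3 := H3 (-1) Pv.
(* The pair (1, -eps/2) in the second field charges 2b to [qa] and to half of [qc]. The other half
   of [qc] pays for the linear term in w through [h4], which leaves a bound independent of w. *)
have h2 : 0 <= 2 * eps^-2 * qa v - 2 * b v w + 1 / 2 * qc w.
  rewrite (_ : _ + _ = 2 * eps^-2 * (1 ^+ 2 * qa v
    + 2 * eps * (1 * - (eps / 2)) * b v w + (- (eps / 2)) ^+ 2 * qc w)); last first.
    by field; rewrite gt_eqF.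
  by rewrite mulr_ge0 ?H2 // mulr_ge0 // invr_ge0 exprn_ge0 // ltW.
lra.
Qed.

Definition saddle_sup v := fine (ereal_sup [set (g v w)%:E | w in S]).

Lemma saddle_supP v : P v ->
  [/\ ereal_sup [set (g v w)%:E | w in S] = (saddle_sup v)%:E,
    forall w, S w -> g v w <= saddle_sup v &
    forall M, (forall w, S w -> g v w <= M) -> saddle_sup v <= M].
Proof.
move=> Pv; have [s [sE s1 s2]] := ereal_sup_bounded SS.1 (fun w => @saddle_le v w Pv).
by rewrite /saddle_sup sE /=.
Qed.

(** For fixed w the convexity defect of g along a segment is s (1 - s) qa(v - u) >= 0, so the
    supremum is convex; [saddle_le] gives its quadratic upper bound, and convex functions of this
    kind are continuous. *)
Lemma saddle_sup_continuous (N : X -> R) (M : R) :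
  (forall s u, P u -> N (s *: u) = s ^+ 2 * N u) ->
  (forall u v, P u -> P v -> N (u + v) <= 2 * N u + 2 * N v) ->
  (forall u, P u -> 0 <= N u) ->
  0 <= M -> (forall u, P u -> qa u <= M * N u) ->
  forall u0, P u0 -> forall e : R, 0 < e ->
  exists2 d : R, 0 < d & forall u, P u -> Num.sqrt (N (u - u0)) < d ->
    `|saddle_sup u - saddle_sup u0| < e.
Proof.
move=> NZ ND N0 M0 qaN; pose k := 2 + 2 * eps^-2.
have k0 : 0 <= k by rewrite addr_ge0 // mulr_ge0 // invr_ge0 exprn_ge0 // ltW.
have PB u v : P u -> P v -> P (v - u).
  by move=> Pu Pv; rewrite -scaleN1r; exact: PP.2.
apply: (@convex_continuous _ _ P N saddle_sup PP.2 NZ ND N0 _ (g 0 0 + 3 * c) (k * M)).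
- move=> s u v Pu Pv s0 s1; have [_ _ h] := saddle_supP (PP.2 s _ _ Pu (PB _ _ Pu Pv)).
  apply: h => w Sw; have [_ hu _] := saddle_supP Pu; have [_ hv _] := saddle_supP Pv.
  have Es := H1 s 0 Pu (PB _ _ Pu Pv) Sw SS.1.
  have E1 := H1 1 0 Pu (PB _ _ Pu Pv) Sw SS.1.
  rewrite scaler0 addr0 in Es; rewrite scaler0 addr0 scale1r addrC subrK in E1.
  have q0 := qa_ge0 (PB _ _ Pu Pv).
  have := ler_wpM2l s0 (hv _ Sw); have : 0 <= 1 - s by lra.
  move=> /ler_wpM2l /(_ _ _ (hu _ Sw)); rewrite Es E1.
  have : 0 <= s * (1 - s) * qa (v - u) by rewrite !mulr_ge0 //; lra.
  nra.
- by rewrite mulr_ge0.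
- move=> u Pu; have [_ _ h] := saddle_supP Pu; apply: h => w Sw.
  apply: (le_trans (saddle_le Pu Sw)); rewrite lerD2l -mulrA.
  by apply: ler_wpM2l; [|exact: qaN].
Qed.

End Minimax.

(** * Exchange of the players and the minimax equality *)

Section Duality.
Variables (R : realType) (X Y : lmodType R) (P : set X) (S : set Y).
Variables (g : X -> Y -> R) (Dv : X -> Y -> X -> R) (Dw : X -> Y -> Y -> R).
Variables (qa : X -> R) (b : X -> Y -> R) (qc : Y -> R) (eps c : R).
Hypothesis H : quadratic_saddle P S g Dv Dw qa b qc eps c.

(** The structure is symmetric under g -> -g with the two players exchanged, so every statement
    about suprema yields the one about infima. *)
Lemma quadratic_saddle_swap :
  quadratic_saddle S P (fun w v => - g v w) (fun w v j => - Dw v w j)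
    (fun w v h => - Dv v w h) qc (fun j h => - b h j) qa eps c.
Proof.
case: H => H1 H2 H3 H4; split.
- move=> w j v h s r Sw Sj Pv Ph; rewrite H1 //; ring.
- move=> j h s r Sj Ph; have := H2 h j r (- s) Ph Sj.
  by rewrite sqrrN; congr (0 <= _); ring.
- by move=> j s Sj; have := H4 j s Sj; rewrite mulrN.
- by move=> h r Ph; have := H3 h r Ph; rewrite mulrN opprK.
Qed.

Hypotheses (PP : lin_closed P) (SS : lin_closed S).
Hypothesis eps0 : 0 < eps.

Definition saddle_inf w := fine (ereal_inf [set (g v w)%:E | v in P]).

Lemma saddle_inf_sup w : S w -> saddle_inf w = - saddle_sup P (fun w v => - g v w) w.
Proof.
move=> Sw; have [h _ _] := saddle_supP quadratic_saddle_swap SS PP eps0 Sw.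
rewrite /saddle_inf /ereal_inf image_comp.
rewrite (_ : (_ \o _) @` P = [set (- g v w)%:E | v in P]) ?h //.
Qed.

Lemma saddle_infP w : S w ->
  [/\ ereal_inf [set (g v w)%:E | v in P] = (saddle_inf w)%:E,
    forall v, P v -> saddle_inf w <= g v w &
    forall M, (forall v, P v -> M <= g v w) -> M <= saddle_inf w].
Proof.
move=> Sw; have [h h1 h2] := saddle_supP quadratic_saddle_swap SS PP eps0 Sw.
rewrite saddle_inf_sup //; split.
- rewrite /ereal_inf image_comp EFinN -h; congr (- ereal_sup _)%E.
- by move=> v Pv; rewrite lerNl h1.
- by move=> M hM; rewrite lerNr; apply: h2 => v Pv; rewrite lerN2 hM.
Qed.

Lemma saddle_minimax :
  ereal_inf [set ereal_sup [set (g v w)%:E | w in S] | v in P] =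
  ereal_sup [set ereal_inf [set (g v w)%:E | v in P] | w in S].
Proof.
have eqS : [set ereal_sup [set (g v w)%:E | w in S] | v in P] =
    [set (saddle_sup S g v)%:E | v in P].
  by apply: eq_imagel => v Pv; have [] := saddle_supP H PP SS eps0 Pv.
have eqI : [set ereal_inf [set (g v w)%:E | v in P] | w in S] =
    [set (saddle_inf w)%:E | w in S].
  by apply: eq_imagel => w Sw; have [] := saddle_infP Sw.
rewrite eqS eqI.
have weak v w : P v -> S w -> saddle_inf w <= saddle_sup S g v.
  move=> Pv Sw; have [_ h1 _] := saddle_supP H PP SS eps0 Pv.
  by have [_ h2 _] := saddle_infP Sw; apply: (le_trans (h2 _ Pv)); exact: h1.
have [M [-> M1 M2]] := ereal_sup_bounded SS.1 (fun w => weak 0 w PP.1).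
have [m [-> m1 m2]] := ereal_inf_bounded PP.1 (fun v Pv => M2 _ (fun w => weak v w Pv)).
congr _%:E; apply/eqP; rewrite eq_le; apply/andP; split; last first.
  by apply: m2 => v Pv; apply: M2 => w Sw; exact: weak.
case: H => H1 H2 H3 H4.
(* [k] is the factor of r^2 qc(j) lost when the first player reacts to a displacement r j of w: 1
   directly, and 2 eps^-2 through the coupling [b]. The total loss in the end is e + 3 k e, whence
   the choice of [e]. *)
pose k := 1 + 2 * eps^-2.
have k1 : 1 <= k by rewrite lerDl mulr_ge0 // invr_ge0 exprn_ge0 // ltW.
apply/ler_addgt0Pr => e' e0'; pose e := e' / (1 + 3 * k).
have e0 : 0 < e by rewrite divr_gt0 //; lra.
have e'E : e' = e + 3 * k * e by rewrite /e; field; rewrite gt_eqF //; lra.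
have [w Sw Mw] : exists2 w, S w & M - e < saddle_inf w.
  apply: contrapT => hn; suff : M <= M - e by lra.
  by apply: M2 => w Sw; rewrite leNgt; apply/negP => h; apply: hn; exists w.
have [_ i1 i2] := saddle_infP Sw.
have [v Pv vw] : exists2 v, P v & g v w < saddle_inf w + e.
  apply: contrapT => hn; suff : saddle_inf w + e <= saddle_inf w by lra.
  by apply: i2 => v Pv; rewrite leNgt; apply/negP => h; apply: hn; exists v.
have PB u u' : P u -> P u' -> P (u' - u).
  by move=> Pu Pu'; rewrite -scaleN1r; exact: PP.2.
have SB u u' : S u -> S u' -> S (u' - u).
  by move=> Pu Pu'; rewrite -scaleN1r; exact: SS.2.
(* Almost minimality of v is tested at v + h/2: half a step keeps half of qa(h) in reserve to absorb
   the coupling term below. *)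
have Dv_ge h : P h -> - (2 * e) <= Dv v w h + 1 / 2 * qa h.
  move=> Ph; have := i1 _ (PP.2 (1 / 2) _ _ Pv Ph).
  have := H1 v h w 0 (1 / 2) 0 Pv Ph Sw SS.1; rewrite scaler0 addr0 => -> //.
  nra.
(* Almost maximality of w bounds the infimum at w + r j from above; [Dv_ge] bounds it from below,
   uniformly in the reply of the first player. With r = 1/k the penalty k r^2 qc, after
   multiplication by k, is exactly the qc(j) occurring in g(v, w + j). *)
have Dw_le j : S j -> Dw v w j - qc j <= 3 * k * e.
  move=> Sj; pose r := k^-1.
  have rk : r * k = 1 by rewrite mulVf // gt_eqF //; lra.
  have Swj : S (w + r *: j) by exact: SS.2.
  have [_ _ h2] := saddle_infP Swj.
  have : g v w + r * Dw v w j - k * r ^+ 2 * qc j - 2 * e <= saddle_inf (w + r *: j).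
    apply: h2 => u Pu; have Ph := PB _ _ Pv Pu.
    have := H1 v (u - v) w j 1 r Pv Ph Sw Sj; rewrite scale1r addrC subrK => -> //.
    have := Dv_ge _ Ph.
    have : 0 <= 1 / 2 * qa (u - v) + 2 * r * b (u - v) j + (k - 1) * r ^+ 2 * qc j.
      rewrite (_ : _ + _ = 1 / 2 * (1 ^+ 2 * qa (u - v) + 2 * eps * (1 * (2 * r / eps)) * b (u - v) j
        + (2 * r / eps) ^+ 2 * qc j)); last by rewrite /k; field; rewrite gt_eqF.
      by rewrite mulr_ge0 // H2.
    nra.
  move=> h3; have h4 := M1 _ Swj; have h5 := i1 _ Pv.
  have h6 : r * Dw v w j - k * r ^+ 2 * qc j <= 3 * e by lra.
  have h7 := ler_wpM2l (_ : 0 <= k) h6.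
  have {h7} := h7 (le_trans ler01 k1).
  rewrite (_ : k * (_ - _) = (r * k) * Dw v w j - (r * k) ^+ 2 * qc j); last ring.
  rewrite rk; nra.
have [_ _ s2] := saddle_supP H PP SS eps0 Pv.
apply: (le_trans (m1 _ Pv)); apply: s2 => u Su; have Sj := SB _ _ Sw Su.
have := H1 v 0 w (u - w) 0 1 Pv PP.1 Sw Sj.
rewrite scaler0 scale1r addr0 addrC subrK => ->.
have := Dw_le _ Sj; have := M1 _ Sw; nra.
Qed.

End Duality.

(** * Square-summable sequences and bilinear pairings *)

Section SquareSummable.
Variable R : realType.

Definition l2N m (f : nat -> 'cV[R]_m) : R := limn (series (fun t => sqn (f t))).

Definition l2S m p (Q : 'M[R]_(m, p)) (f : nat -> 'cV[R]_m) (g : nat -> 'cV[R]_p) : R :=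
  limn (series (fun t => bil Q (f t) (g t))).

Lemma series_sqn_nd m (f : nat -> 'cV[R]_m) :
  nondecreasing_seq (series (fun t => sqn (f t))).
Proof. by apply: nondecreasing_series => t _ _; exact: sqn_ge0. Qed.

Lemma l2_bounded m (f : nat -> 'cV[R]_m) (M : R) :
  (forall T, \sum_(t < T) sqn (f t) <= M) -> l2 m f.
Proof.
move=> h; apply: nondecreasing_is_cvgn; first exact: series_sqn_nd.
by exists M => _ [T _ <-]; rewrite /series /= big_mkord.
Qed.

Lemma l2N_ge m (f : nat -> 'cV[R]_m) T : l2 m f -> \sum_(t < T) sqn (f t) <= l2N f.
Proof.
move=> lf; have := nondecreasing_cvgn_le (series_sqn_nd f) lf T.
by rewrite /series /= big_mkord.
Qed.

Lemma l2N_ge0 m (f : nat -> 'cV[R]_m) : l2 m f -> 0 <= l2N f.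
Proof. by move=> /(@l2N_ge _ _ 0); rewrite big_ord0. Qed.

Lemma l2N_le m (f : nat -> 'cV[R]_m) (M : R) :
  (forall T, \sum_(t < T) sqn (f t) <= M) -> l2N f <= M.
Proof.
move=> h; apply: limr_le; first exact: l2_bounded h.
by apply: nearW => T; rewrite /series /= big_mkord.
Qed.

Lemma l2_linear m (s : R) (f g : nat -> 'cV[R]_m) : l2 m f -> l2 m g -> l2 m (f + s *: g).
Proof.
move=> lf lg; apply: (@l2_bounded _ _ (2 * l2N f + 2 * (s ^+ 2 * l2N g))) => T.
apply: (@le_trans _ _ (2 * (\sum_(t < T) sqn (f t)) + 2 * (s ^+ 2 * \sum_(t < T) sqn (g t)))).
  rewrite !mulr_sumr -big_split; apply: ler_sum => t _ /=.
  by apply: (le_trans (sqnD_le _ _)); rewrite sqnZ.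
by rewrite lerD // ler_wpM2l // ?l2N_ge // ler_wpM2l ?sqr_ge0 ?l2N_ge.
Qed.

Arguments l2_linear {m} s {f g}.

Lemma l2_0 m : l2 m (0 : nat -> 'cV[R]_m).
Proof. by apply: (@l2_bounded _ _ 0) => T; rewrite big1 // => t _; exact: sqn0. Qed.

Lemma l2_lin_closed m : lin_closed (l2 m : set (nat -> 'cV[R]_m)).
Proof. by split; [exact: l2_0 | exact: l2_linear]. Qed.

Lemma l2_mulmx p m (M : 'M[R]_(p, m)) f : l2 m f -> l2 p (fun t => M *m f t).
Proof.
move=> lf; have [c c0 hc] := sqn_mulmx M; apply: (@l2_bounded _ _ (c * l2N f)) => T.
apply: (@le_trans _ _ (c * \sum_(t < T) sqn (f t))).
  by rewrite mulr_sumr; apply: ler_sum => t _; exact: hc.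
by rewrite ler_wpM2l ?(ltW c0) // l2N_ge.
Qed.

Section Bilinear.
Variables (m p : nat) (Q : 'M[R]_(m, p)).

Lemma l2S_cvg f g : l2 m f -> l2 p g -> cvgn (series (fun t => bil Q (f t) (g t))).
Proof.
move=> lf lg.
have : cvgn (series (fun t => `|bil Q (f t) (g t)|)); last exact: normed_cvg.
apply: nondecreasing_is_cvgn; first by apply: nondecreasing_series => t _ _ /=.
exists (mxabs Q * (1 * l2N f + 1^-1 * l2N g)) => _ [T _ <-]; rewrite /series /= big_mkord.
apply: (@le_trans _ _ (mxabs Q * (1 * (\sum_(t < T) sqn (f t)) + 1^-1 * \sum_(t < T) sqn (g t)))).
  rewrite !mulr_sumr -big_split mulr_sumr; apply: ler_sum => t _ /=; exact: bil_le.
by rewrite invr1 !mul1r ler_wpM2l ?(ltW (mxabs_gt0 _)) // lerD // l2N_ge.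
Qed.

Lemma l2S_le f g (e : R) : 0 < e -> l2 m f -> l2 p g ->
  `|l2S Q f g| <= mxabs Q * (e * l2N f + e^-1 * l2N g).
Proof.
move=> e0 lf lg; have ei : 0 < e^-1 by rewrite invr_gt0.
have h T : `|series (fun t => bil Q (f t) (g t)) T| <= mxabs Q * (e * l2N f + e^-1 * l2N g).
  rewrite /series /= big_mkord; apply: (le_trans (ler_norm_sum _ _ _)).
  apply: (@le_trans _ _ (mxabs Q * (e * (\sum_(t < T) sqn (f t)) + e^-1 * \sum_(t < T) sqn (g t)))).
    rewrite !mulr_sumr -big_split mulr_sumr; apply: ler_sum => t _ /=; exact: bil_le.
  by rewrite ler_wpM2l ?(ltW (mxabs_gt0 _)) // lerD // ler_wpM2l ?(ltW e0) ?(ltW ei) // l2N_ge.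
rewrite ler_norml; apply/andP; split.
  apply: limr_ge; first exact: l2S_cvg.
  by apply: nearW => T; have := h T; rewrite ler_norml => /andP[].
apply: limr_le; first exact: l2S_cvg.
by apply: nearW => T; have := h T; rewrite ler_norml => /andP[].
Qed.

Lemma l2S_linl s f f' g : l2 m f -> l2 m f' -> l2 p g ->
  l2S Q (f + s *: f') g = l2S Q f g + s * l2S Q f' g.
Proof.
move=> lf lf' lg; apply: cvg_lim => //.
rewrite (_ : (fun t => _) = (fun t => bil Q (f t) (g t)) + s *: (fun t => bil Q (f' t) (g t))); last first.
  by apply/funext => t; rewrite /= bilDl bilZl.
rewrite seriesD seriesZ; apply: cvgD; first exact: l2S_cvg.
by apply: cvgZr; exact: l2S_cvg.
Qed.

Lemma l2S_linr s f g g' : l2 m f -> l2 p g -> l2 p g' ->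
  l2S Q f (g + s *: g') = l2S Q f g + s * l2S Q f g'.
Proof.
move=> lf lg lg'; apply: cvg_lim => //.
rewrite (_ : (fun t => _) = (fun t => bil Q (f t) (g t)) + s *: (fun t => bil Q (f t) (g' t))); last first.
  by apply/funext => t; rewrite /= bilDr bilZr.
rewrite seriesD seriesZ; apply: cvgD; first exact: l2S_cvg.
by apply: cvgZr; exact: l2S_cvg.
Qed.

End Bilinear.

Lemma l2S_sym m (Q : 'M[R]_m) f g : Q^T = Q -> l2S Q f g = l2S Q g f.
Proof. by move=> sQ; congr (limn (series _)); apply/funext => t; exact: bil_sym. Qed.

Lemma l2N_S m (f : nat -> 'cV[R]_m) : l2N f = l2S 1%:M f f.
Proof. by congr (limn (series _)); apply/funext => t; rewrite /bil mulmx1. Qed.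

Lemma l2NZ m s (f : nat -> 'cV[R]_m) : l2 m f -> l2N (s *: f) = s ^+ 2 * l2N f.
Proof.
move=> lf; have l0 := @l2_0 m; have lsf := l2_linear s l0 lf; rewrite add0r in lsf.
have z g : l2 m g -> l2S 1%:M (0 : nat -> 'cV[R]_m) g = 0.
  move=> lg; have := l2S_linl 1%:M (-1) lg lg lg; rewrite scaleN1r subrr => ->.
  by rewrite mulN1r subrr.
have zl g : l2 m g -> l2S 1%:M (s *: f) g = s * l2S 1%:M f g.
  by move=> lg; have := l2S_linl 1%:M s l0 lf lg; rewrite z // !add0r.
by rewrite !l2N_S zl // l2S_sym ?trmx1 // zl // mulrA expr2.
Qed.

Lemma l2ND m (f g : nat -> 'cV[R]_m) : l2 m f -> l2 m g ->
  l2N (f + g) <= 2 * l2N f + 2 * l2N g.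
Proof.
move=> lf lg; apply: l2N_le => T.
apply: (@le_trans _ _ (2 * (\sum_(t < T) sqn (f t)) + 2 * \sum_(t < T) sqn (g t))).
  by rewrite !mulr_sumr -big_split; apply: ler_sum => t _ /=; exact: sqnD_le.
by rewrite lerD // ler_wpM2l // l2N_ge.
Qed.

Definition trunc m T (f : nat -> 'cV[R]_m) t : 'cV[R]_m := if (t < T)%N then f t else 0.

Lemma l2_finite m T (f : nat -> 'cV[R]_m) : (forall t, (T <= t)%N -> f t = 0) -> l2 m f.
Proof.
move=> h; apply: (@l2_bounded _ _ (\sum_(t < T) sqn (f t))) => T'.
have st (a b : nat) : (a <= b)%N -> \sum_(t < a) sqn (f t) <= \sum_(t < b) sqn (f t).
  move=> ab; have := series_sqn_nd f ab; by rewrite /series /= !big_mkord.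
case: (leqP T' T) => [/st //|/ltnW TT'].
rewrite -(big_mkord xpredT (fun t => sqn (f t))) (big_cat_nat (n := T)) //= big_mkord.
rewrite [X in _ + X <= _]big_nat_cond [X in _ + X <= _]big1 ?addr0 // => t /andP[/andP[Tt _] _].
by rewrite h // sqn0.
Qed.

Lemma l2_trunc m T (f : nat -> 'cV[R]_m) : l2 m (trunc T f).
Proof. by apply: (@l2_finite m T) => t Tt; rewrite /trunc ltnNge Tt. Qed.

Lemma trunc_approx m (f : nat -> 'cV[R]_m) (e : R) : l2 m f -> 0 < e ->
  exists T, l2N (f - trunc T f) <= e.
Proof.
move=> lf e0; have [T hT] : exists T, l2N f - e < \sum_(t < T) sqn (f t).
  apply: contrapT => hn; suff : l2N f <= l2N f - e by lra.
  by apply: l2N_le => T; rewrite leNgt; apply/negP => h; apply: hn; exists T.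
exists T; apply: l2N_le => T'; apply: (@le_trans _ _ (\sum_(t < T + T') sqn ((f - trunc T f) t))).
  by have := series_sqn_nd (f - trunc T f) (leq_addl T T'); rewrite /series /= !big_mkord.
have hTT := l2N_ge (T + T') lf; rewrite big_split_ord /= in hTT.
rewrite big_split_ord /= big1 ?add0r => [|t _]; last first.
  by rewrite !fctE /= /trunc ltn_ord subrr sqn0.
rewrite (eq_bigr (fun t : 'I_T' => sqn (f (T + t)%N))) => [|t _]; first lra.
by rewrite !fctE /= /trunc ltnNge leq_addr subr0.
Qed.

End SquareSummable.

Arguments l2_linear {R m} s {f g}.
Arguments l2S_cvg {R m p} Q {f g}.
Arguments l2_trunc {R m} T f.
Arguments l2_finite {R m} T {f}.
Arguments l2_mulmx {R p m} M {f}.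

(** * State and output responses of the linear system *)

Section StateSpace.
Variables (R : realType) (n : nat) (A : 'M[R]_n).

Fixpoint state (x0 : 'cV[R]_n) (f : nat -> 'cV[R]_n) t : 'cV[R]_n :=
  if t is t'.+1 then A *m state x0 f t' + f t' else x0.

Lemma state_free x0 f t : state x0 f t = expmx A t *m x0 + state 0 f t.
Proof.
elim: t => [|t ih] /=; first by rewrite mul1mx addr0.
by rewrite ih mulmxDr mulmxA addrA.
Qed.

Lemma state_linear s f g t : state 0 (f + s *: g) t = state 0 f t + s *: state 0 g t.
Proof.
elim: t => [|t ih] /=; first by rewrite scaler0 addr0.
by rewrite ih mulmxDr -scalemxAr scalerDr addrACA.
Qed.

Lemma state_after f T t : (forall s, (T <= s)%N -> f s = 0) ->
  state 0 f (T + t) = expmx A t *m state 0 f T.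
Proof.
move=> h; elim: t => [|t ih]; first by rewrite addn0 mul1mx.
by rewrite addnS /= ih h ?leq_addr // addr0 mulmxA.
Qed.

Hypothesis sA : schur A.

Lemma l2_state x0 f : l2 n f -> l2 n (state x0 f).
Proof.
move=> lf; have [c c0 h] := schur_energy sA.
apply: (@l2_bounded _ _ _ (c * (sqn x0 + l2N f))) => T.
have := h (state x0 f) f (fun=> erefl) T => /le_trans; apply.
by rewrite ler_wpM2l ?(ltW c0) // lerD2l l2N_ge.
Qed.

Lemma l2N_state : {c : R | 0 < c & forall f, l2 n f -> l2N (state 0 f) <= c * l2N f}.
Proof.
have [c c0 h] := schur_energy sA; exists c => // f lf; apply: l2N_le => T.
have := h (state 0 f) f (fun=> erefl) T => /le_trans; apply.
by rewrite /= sqn0 add0r ler_wpM2l ?(ltW c0) // l2N_ge.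
Qed.

Lemma l2_free x0 : l2 n (fun t => expmx A t *m x0).
Proof.
have [c c0 h] := expmx_energy sA; exact: (@l2_bounded _ _ _ (c * sqn x0)).
Qed.

End StateSpace.

Arguments l2_state {R n A} sA x0 {f}.
Arguments l2_free {R n A} sA x0.

Section Output.
Variables (R : realType) (n m p : nat).
Variables (A : 'M[R]_n) (B : 'M[R]_(n, m)) (C : 'M[R]_(p, n)) (E : 'M[R]_(p, m)).

Definition output (u : nat -> 'cV[R]_m) t : 'cV[R]_p :=
  C *m state A 0 (fun s => B *m u s) t + E *m u t.

Lemma output_linear s u v : output (u + s *: v) = output u + s *: output v.
Proof.
apply/funext => t; rewrite !fctE /output /=.
rewrite (_ : (fun s0 => _) = (fun t => B *m u t) + s *: (fun t => B *m v t)); last first.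
  by apply/funext => i; rewrite !fctE /= mulmxDr -scalemxAr.
by rewrite state_linear !mulmxDr -!scalemxAr scalerDr addrACA.
Qed.

Hypothesis sA : schur A.

Lemma l2_output u : l2 m u -> l2 p (output u).
Proof.
move=> lu; have h := l2_linear 1 (l2_mulmx C (l2_state sA 0 (l2_mulmx B lu))) (l2_mulmx E lu).
by rewrite scale1r in h.
Qed.

Lemma l2N_mulmx p' m' (M : 'M[R]_(p', m')) :
  {c : R | 0 < c & forall f, l2 m' f -> l2N (fun t => M *m f t) <= c * l2N f}.
Proof.
have [c c0 hc] := sqn_mulmx M; exists c => // f lf; apply: l2N_le => T.
apply: (@le_trans _ _ (c * \sum_(t < T) sqn (f t))).
  by rewrite mulr_sumr; apply: ler_sum => t _; exact: hc.
by rewrite ler_wpM2l ?(ltW c0) // l2N_ge.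
Qed.

Lemma l2N_output : {c : R | 0 < c & forall u, l2 m u -> l2N (output u) <= c * l2N u}.
Proof.
have [c1 p1 h1] := l2N_mulmx B; have [c2 p2 h2] := l2N_state sA.
have [c3 p3 h3] := l2N_mulmx C; have [c4 p4 h4] := l2N_mulmx E.
exists (2 * (c3 * (c2 * c1)) + 2 * c4) => [|u lu].
  by rewrite addr_gt0 // !mulr_gt0.
have lB := l2_mulmx B lu; have lx := l2_state sA 0 lB.
have h := l2ND (l2_mulmx C lx) (l2_mulmx E lu).
apply: (le_trans h); rewrite [leRHS]mulrDl -!mulrA; apply: lerD; apply: ler_wpM2l => //.
  apply: (le_trans (h3 _ lx)); apply: ler_wpM2l; first exact: ltW.
  apply: (le_trans (h2 _ lB)); apply: ler_wpM2l; first exact: ltW.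
  exact: h1.
exact: h4.
Qed.

End Output.

Arguments l2_output {R n m p A} B C E sA {u}.

(** * Finite Fourier transform at roots of unity *)

Section Fourier.
Variable R : realType.
Local Notation C := R[i].

Lemma mulmx_inj_unitmx (K : fieldType) n (M : 'M[K]_n) :
  (forall x : 'cV_n, M *m x = 0 -> x = 0) -> M \in unitmx.
Proof.
move=> h; rewrite -unitmx_tr -row_free_unit -kermx_eq0; apply/rowV0P => v /sub_kermxP vM.
apply: trmx_inj; rewrite trmx0; apply: h.
by rewrite -[M]trmxK -trmx_mul vM trmx0.
Qed.

Lemma unity_root_norm (w : C) T : (0 < T)%N -> w ^+ T = 1 -> `|w| = 1.
Proof.
move=> T0 wT; apply/eqP; rewrite -(@pexpr_eq1 _ _ T) //.
by rewrite -normrX wT normr1.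
Qed.

Lemma conjc_unit (w : C) : `|w| = 1 -> (w^*)%C = w^-1.
Proof. by move=> w1; rewrite [RHS]invc_norm w1 expr1n invr1 mul1r. Qed.

(** In characteristic zero X^T - 1 is separable, so it has T distinct roots, and T distinct T-th
    roots of unity in a field include a primitive one. *)
Lemma prim_root_exists T : (0 < T)%N -> {z : C | T.-primitive_root z}.
Proof.
move=> T0; have [r Er] := closed_field_poly_normal ('X^T - 1 : {poly C}).
rewrite (monicP (monicXnsubC _ T0)) scale1r in Er.
apply/sigW; have /hasP[z _ pz] : has T.-primitive_root r; last by exists z.
apply: has_prim_root => //.
- by apply/allP => z; rewrite -root_prod_XsubC -Er.
- by rewrite -separable_prod_XsubC -Er separable_Xn_sub_1 // pnatr_eq0 -lt0n.
- by rewrite -ltnS -(size_prod_XsubC r id) -Er size_XnsubC.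
Qed.

Definition ses m p (M : 'M[C]_(m, p)) (x : 'cV[C]_m) (y : 'cV[C]_p) : C :=
  (ctr x *m M *m y) 0 0.

Lemma ctrD m p (M N : 'M[C]_(m, p)) : ctr (M + N) = ctr M + ctr N.
Proof. by apply/matrixP => i j; rewrite !mxE rmorphD. Qed.
Lemma ctr0 m p : ctr (0 : 'M[C]_(m, p)) = 0.
Proof. by apply/matrixP => i j; rewrite !mxE rmorph0. Qed.
Lemma ctrM m p l (M : 'M[C]_(m, p)) (N : 'M[C]_(p, l)) : ctr (M *m N) = ctr N *m ctr M.
Proof. by rewrite /ctr map_mxM trmx_mul. Qed.
Lemma ctrZ m p s (M : 'M[C]_(m, p)) : ctr (s *: M) = (s^*)%C *: ctr M.
Proof. by apply/matrixP => i j; rewrite !mxE rmorphM. Qed.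
Lemma ctrK m p (M : 'M[C]_(m, p)) : ctr (ctr M) = M.
Proof. by apply/matrixP => i j; rewrite !mxE conjcK. Qed.
Lemma ctr_cmx m p (M : 'M[R]_(m, p)) : ctr (cmx M) = cmx M^T.
Proof. by apply/matrixP => i j; rewrite !mxE conjc_real. Qed.

Lemma sesDl m p (M : 'M[C]_(m, p)) x1 x2 y : ses M (x1 + x2) y = ses M x1 y + ses M x2 y.
Proof. by rewrite /ses ctrD !mulmxDl mxE. Qed.
Lemma sesDr m p (M : 'M[C]_(m, p)) x y1 y2 : ses M x (y1 + y2) = ses M x y1 + ses M x y2.
Proof. by rewrite /ses mulmxDr mxE. Qed.
Lemma sesZl m p (M : 'M[C]_(m, p)) s x y : ses M (s *: x) y = (s^*)%C * ses M x y.
Proof. by rewrite /ses ctrZ -!scalemxAl mxE. Qed.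
Lemma sesZr m p (M : 'M[C]_(m, p)) s x y : ses M x (s *: y) = s * ses M x y.
Proof. by rewrite /ses -!scalemxAr mxE. Qed.
Lemma ses0l m p (M : 'M[C]_(m, p)) y : ses M 0 y = 0.
Proof. by rewrite /ses ctr0 !mul0mx mxE. Qed.
Lemma ses0r m p (M : 'M[C]_(m, p)) x : ses M x 0 = 0.
Proof. by rewrite /ses mulmx0 mxE. Qed.

Lemma ses_suml m p (M : 'M[C]_(m, p)) (I : Type) (r : seq I) F y :
  ses M (\sum_(i <- r) F i) y = \sum_(i <- r) ses M (F i) y.
Proof. by elim: r => [|i r ih]; rewrite ?big_nil ?ses0l // !big_cons sesDl ih. Qed.

Lemma ses_sumr m p (M : 'M[C]_(m, p)) (I : Type) (r : seq I) x F :
  ses M x (\sum_(i <- r) F i) = \sum_(i <- r) ses M x (F i).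
Proof. by elim: r => [|i r ih]; rewrite ?big_nil ?ses0r // !big_cons sesDr ih. Qed.

Lemma ses_cmx m p (Q : 'M[R]_(m, p)) x y : ses (cmx Q) (cmx x) (cmx y) = (bil Q x y)%:C%C.
Proof. by rewrite /ses ctr_cmx -!cmxM /bil mxE. Qed.

Lemma ses1 m (x : 'cV[C]_m) : ses 1%:M x x = (nsqC x)%:C%C.
Proof.
rewrite /ses mulmx1 mxE /nsqC rmorph_sum; apply: eq_bigr => i _.
by rewrite !mxE /= csqE sqr_normc mulrC.
Qed.

Definition dft m T (f : nat -> 'cV[C]_m) (w : C) : 'cV[C]_m :=
  \sum_(t < T) w^-1 ^+ t *: f t.

Lemma dft_orthogonal T (z : C) (s t : 'I_T) : T.-primitive_root z ->
  \sum_(j < T) ((z ^+ j)^-1 ^+ s)^*%C * (z ^+ j)^-1 ^+ t = (T * (s == t))%:R.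
Proof.
move=> pz; have T0 : (0 < T)%N := prim_order_gt0 pz.
have z1 : `|z| = 1 := unity_root_norm T0 (prim_expr_order pz).
have z0 : z != 0 by rewrite -normr_eq0 z1 oner_eq0.
pose x := z ^+ s / z ^+ t.
have -> : \sum_(j < T) ((z ^+ j)^-1 ^+ s)^*%C * (z ^+ j)^-1 ^+ t = \sum_(j < T) x ^+ j.
  apply: eq_bigr => j _; rewrite conjc_unit; last first.
    by rewrite normrX normfV normrX z1 !expr1n invr1 expr1n.
  by rewrite /x expr_div_n !exprVn invrK -!exprM (mulnC j s) (mulnC j t).
case: eqP => [st|/eqP st].
  rewrite muln1 /x st divff ?expf_neq0 //.
  by under eq_bigr do rewrite expr1n; rewrite sumr_const card_ord.
rewrite muln0; have x1 : x - 1 != 0.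
  rewrite subr_eq0; apply: contra st => /eqP xE.
  have : z ^+ s = z ^+ t by rewrite -[LHS](divfK (expf_neq0 t z0)) -/x xE mul1r.
  move/eqP; rewrite (eq_prim_root_expr pz) !modn_small //.
apply: (mulfI x1); rewrite -subrX1 mulr0 /x expr_div_n -!exprM mulnC exprM.
by rewrite (prim_expr_order pz) expr1n mulnC exprM (prim_expr_order pz) expr1n divr1 subrr.
Qed.

(** The transform is not normalized, which is where the factor T comes from; only the diagonal s = t
    survives orthogonality. *)
Lemma dft_parseval T (z : C) m p (M : 'M[C]_(m, p)) f g : T.-primitive_root z ->
  \sum_(j < T) ses M (dft T f (z ^+ j)) (dft T g (z ^+ j)) =
  T%:R * \sum_(t < T) ses M (f t) (g t).
Proof.
move=> pz; have -> : \sum_(j < T) ses M (dft T f (z ^+ j)) (dft T g (z ^+ j)) =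
    \sum_(j < T) \sum_(s < T) \sum_(t < T)
     (((z ^+ j)^-1 ^+ s)^*%C * (z ^+ j)^-1 ^+ t) * ses M (f s) (g t).
  apply: eq_bigr => j _; rewrite ses_suml; apply: eq_bigr => s _.
  by rewrite ses_sumr; apply: eq_bigr => t _; rewrite sesZl sesZr mulrA.
rewrite exchange_big mulr_sumr; apply: eq_bigr => s _ /=.
rewrite exchange_big (bigD1 s) //= [X in _ + X]big1 ?addr0 => [|t ts].
  by rewrite -mulr_suml dft_orthogonal // eqxx muln1.
by rewrite -mulr_suml dft_orthogonal // eq_sym (negbTE ts) muln0 mul0r.
Qed.

End Fourier.

(** * Periodic responses and the transfer function *)

Section PeriodicResponse.
Variables (R : realType) (n m p : nat).
Variables (A : 'M[R]_n) (B : 'M[R]_(n, m)) (D : 'M[R]_(p, n)) (E : 'M[R]_(p, m)).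
Local Notation C := R[i].

Definition transfer (w : C) : 'M[C]_(p, m) :=
  cmx D *m (invmx (w%:M - cmx A) *m cmx B) + cmx E.

Hypothesis sA : schur A.

(** Multiplying the transform of the state by w shifts the index by one, and the boundary term
    closes up because x(T) = x(0) and w^T = 1. Hence (w - A) X = B U holds exactly, without a
    remainder. *)
Lemma dft_periodic T x0 (u : nat -> 'cV[R]_m) (w : C) : (0 < T)%N -> w ^+ T = 1 ->
  state A x0 (fun t => B *m u t) T = x0 ->
  dft T (fun t => cmx (D *m state A x0 (fun t => B *m u t) t + E *m u t)) w =
  transfer w *m dft T (fun t => cmx (u t)) w.
Proof.
move=> T0 wT xT; set x := state A x0 _ in xT *.
have w1 : `|w| = 1 := unity_root_norm T0 wT.
have w0 : w != 0 by rewrite -normr_eq0 w1 oner_eq0.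
set X := dft T (fun t => cmx (x t)) w; set U := dft T (fun t => cmx (u t)) w.
have ux : w%:M - cmx A \in unitmx by apply: sA; rewrite w1.
have eX : (w%:M - cmx A) *m X = cmx B *m U.
  have e1 : w *: X = \sum_(t < T) w^-1 ^+ t *: cmx (x t.+1).
    have -> : X = \sum_(t < T) w^-1 ^+ t.+1 *: cmx (x t.+1).
      have : \sum_(t < T.+1) w^-1 ^+ t *: cmx (x t) = \sum_(t < T.+1) w^-1 ^+ t *: cmx (x t) by [].
      rewrite {1}big_ord_recr big_ord_recl /= exprVn wT invr1 expr0 xT addrC => /addrI; exact.
    rewrite scaler_sumr; apply: eq_bigr => t _.
    by rewrite scalerA exprS mulrA divff // mul1r.
  rewrite mulmxBl mul_scalar_mx e1 mulmx_sumr mulmx_sumr -sumrB; apply: eq_bigr => t _.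
  by rewrite -!scalemxAr -scalerBr /x /= -/x cmxD !cmxM addrC addKr.
have XE : X = invmx (w%:M - cmx A) *m (cmx B *m U) by rewrite -eX mulKmx.
rewrite /transfer mulmxDl -!mulmxA -XE /X /U /dft !mulmx_sumr -big_split.
by apply: eq_bigr => t _ /=; rewrite -!scalemxAr -scalerDr cmxD !cmxM.
Qed.

(* For T large the T-periodic response to a finitely supported input is well defined, and
   it differs from the response from rest by a free motion with small initial state. *)
Lemma periodic_output (u : nat -> 'cV[R]_m) L (d : R) :
  (forall t, (L <= t)%N -> u t = 0) -> 0 < d ->
  exists T0, forall T, (T0 <= T)%N -> exists2 y : nat -> 'cV[R]_p,
    \sum_(t < T) sqn (y t - output A B D E u t) <= d &
    forall w : C, w ^+ T = 1 ->
      dft T (fun t => cmx (y t)) w = transfer w *m dft T (fun t => cmx (u t)) w.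
Proof.
move=> uL d0; have [c1 c10 h1] := expmx_small sA; have [c2 c20 h2] := expmx_energy sA.
have [c3 c30 h3] := sqn_mulmx D.
set f := fun t => B *m u t.
have fL t : (L <= t)%N -> f t = 0 by move=> Lt; rewrite /f uL // mulmx0.
(* The first summand gives |A^T x|^2 <= |x|^2 / 4, hence the invertibility of 1 - A^T and the bound
   |x0|^2 <= 4 |x_T|^2. The second makes the energy of the output error at most [d], since |x_T|^2
   decays like 1/(T - L) once the input has stopped. *)
pose K := 4 * c1 + c3 * c2 * (4 * c1 * sqn (state A 0 f L)) / d.
have [c1' c2' c3' d'] := And4 (ltW c10) (ltW c20) (ltW c30) (ltW d0).
have K0 : 0 <= K by rewrite /K addr_ge0 ?divr_ge0 ?mulr_ge0 ?sqn_ge0.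
pose T1 := (Num.truncn K).+1.
have T1K : K < T1%:R by exact: truncnS_gt.
exists (L + T1)%N => T LT.
have TK : K < (T - L)%:R.
  by apply: (lt_le_trans T1K); rewrite ler_nat leq_subRL // (leq_trans (leq_addr _ _) LT).
have T0 : (0 < T)%N by apply: leq_trans LT; rewrite addnS.
have LT' : (L <= T)%N by apply: leq_trans LT; exact: leq_addr.
have Kc : 4 * c1 <= K.
  by rewrite lerDl divr_ge0 ?mulr_ge0 ?sqn_ge0.
have TK' : K < T%:R by apply: (lt_le_trans TK); rewrite ler_nat leq_subr.
have uM : 1%:M - expmx A T \in unitmx.
  apply: mulmx_inj_unitmx => x; rewrite mulmxBl mul1mx => /eqP; rewrite subr_eq0 => /eqP xE.
  apply: sqn_eq0; have := h1 x T; rewrite -xE; have := sqn_ge0 x; nra.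
(* The initial state of the periodic motion is the fixed point of x -> A^T x + x_T, with x_T the
   state reached from rest. *)
pose x0 := invmx (1%:M - expmx A T) *m state A 0 f T.
have x0E : expmx A T *m x0 + state A 0 f T = x0.
  have : (1%:M - expmx A T) *m x0 = state A 0 f T by rewrite mulKVmx.
  by rewrite mulmxBl mul1mx => <-; rewrite addrC subrK.
have x0_le : sqn x0 <= 4 * sqn (state A 0 f T).
  have := sqnD_le (expmx A T *m x0) (state A 0 f T); rewrite x0E.
  have := h1 x0 T; have := sqn_ge0 (expmx A T *m x0); have := sqn_ge0 x0.
  have : 4 * c1 * sqn (expmx A T *m x0) <= c1 * sqn x0 -> 4 * sqn (expmx A T *m x0) <= sqn x0.
    by rewrite mulrAC mulrC ler_pM2l.
  nra.
have xT : state A 0 f T = expmx A (T - L) *m state A 0 f L.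
  by rewrite -(state_after _ _ fL) subnKC.
exists (fun t => D *m state A x0 f t + E *m u t) => [|w wT]; last first.
  by apply: dft_periodic => //; rewrite -/f state_free x0E.
apply: (@le_trans _ _ (\sum_(t < T) c3 * sqn (expmx A t *m x0))).
  apply: ler_sum => t _; apply: le_trans (h3 _).
  rewrite /output -/f opprD addrACA subrr addr0 -mulmxBr.
  by rewrite (state_free A x0) addrK.
rewrite -mulr_sumr; apply: (@le_trans _ _ (c3 * (c2 * (4 * sqn (state A 0 f T))))).
  rewrite ler_pM2l //; apply: (le_trans (h2 _ _)); by rewrite ler_pM2l.
have h := h1 (state A 0 f L) (T - L)%N; rewrite -xT in h.
have s0 := sqn_ge0 (state A 0 f T).
have Ks : K * sqn (state A 0 f T) <= c1 * sqn (state A 0 f L) by nra.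
have sd : c3 * c2 * (4 * c1 * sqn (state A 0 f L)) <= K * d.
  by rewrite /K [leRHS]mulrDl divfK ?gt_eqF // lerDr !mulr_ge0.
have Kp : 0 < K by apply: lt_le_trans Kc; rewrite mulr_gt0.
rewrite -(ler_pM2l Kp); apply: le_trans sd.
have c23 : 0 <= c3 * c2 * 4 by rewrite !mulr_ge0.
have := ler_wpM2l c23 Ks; lra.
Qed.

End PeriodicResponse.

(** * Trigonometric polynomials on the unit circle *)

Section TrigonometricPolynomials.
Variable R : realType.
Local Notation C := R[i].

(** Laurent polynomials seen through their values on the circle only; there conjugation of w is
    inversion, so the class is closed under conjugation as well. *)
Definition tpoly (phi : C -> C) := exists (P : {poly C}) (d : nat),
  forall w, `|w| = 1 -> phi w * w ^+ d = P.[w].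

Lemma tpoly_const c : tpoly (fun=> c).
Proof. by exists c%:P, 0%N => w _; rewrite hornerC mulr1. Qed.

Lemma tpoly_id : tpoly id.
Proof. by exists 'X, 0%N => w _; rewrite hornerX mulr1. Qed.

Lemma tpolyD f g : tpoly f -> tpoly g -> tpoly (fun w => f w + g w).
Proof.
move=> [P [d hP]] [Q [e hQ]]; exists (P * 'X^e + Q * 'X^d), (d + e)%N => w w1.
by rewrite hornerD !hornerM !hornerXn -hP // -hQ // exprD; ring.
Qed.

Lemma tpolyM f g : tpoly f -> tpoly g -> tpoly (fun w => f w * g w).
Proof.
move=> [P [d hP]] [Q [e hQ]]; exists (P * Q), (d + e)%N => w w1.
by rewrite !hornerM -hP // -hQ // exprD; ring.
Qed.

Lemma tpoly_sum (I : Type) (r : seq I) (F : I -> C -> C) :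
  (forall i, tpoly (F i)) -> tpoly (fun w => \sum_(i <- r) F i w).
Proof.
move=> h; elim: r => [|i r ih].
  by under eq_fun do rewrite big_nil; exact: tpoly_const.
by under eq_fun do rewrite big_cons; exact: tpolyD.
Qed.

Lemma tpoly_prod (I : Type) (r : seq I) (F : I -> C -> C) :
  (forall i, tpoly (F i)) -> tpoly (fun w => \prod_(i <- r) F i w).
Proof.
move=> h; elim: r => [|i r ih].
  by under eq_fun do rewrite big_nil; exact: tpoly_const.
by under eq_fun do rewrite big_cons; exact: tpolyM.
Qed.

Lemma tpoly_conj f : tpoly f -> tpoly (fun w => (f w)^*%C).
Proof.
move=> [P [d hP]]; pose N := size P.
exists ((\sum_(i < N) (P`_i)^*%C *: 'X^(N - i)) * 'X^d), N => w w1.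
have w0 : w != 0 by rewrite -normr_eq0 w1 oner_eq0.
have /(congr1 (@conjc R)) := hP w w1.
rewrite rmorphM rmorphXn /= (conjc_unit w1) => e.
have -> : (f w)^*%C = (P.[w])^*%C * w ^+ d.
  by rewrite -e exprVn -mulrA mulVf ?expf_neq0 // mulr1.
rewrite hornerM hornerXn mulrAC; congr (_ * _).
rewrite horner_coef rmorph_sum mulr_suml horner_sum; apply: eq_bigr => i _ /=.
rewrite hornerZ hornerXn rmorphM rmorphXn /= (conjc_unit w1) -mulrA; congr (_ * _).
by rewrite exprB ?unitfE // ?(ltnW (ltn_ord i)) // exprVn mulrC.
Qed.

Lemma tpoly_bounded f : tpoly f -> exists c : R, forall w, `|w| = 1 -> csq (f w) <= c.
Proof.
move=> [P [d hP]].
exists ((2 ^ size (index_enum 'I_(size P)))%:R * \sum_(i < size P) csq P`_i) => w w1.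
have cw k : csq (w ^+ k) = 1 by apply/csq1P; rewrite normrX w1 expr1n.
have -> : csq (f w) = csq P.[w] by rewrite -hP // csqM cw mulr1.
rewrite horner_coef; apply: (le_trans (csq_sum_le _ _)); rewrite ler_wpM2l //.
by apply: ler_sum => i _; rewrite csqM cw mulr1.
Qed.

Definition tpoly_mx m p (M : C -> 'M[C]_(m, p)) := forall i j, tpoly (fun w => M w i j).

Lemma tpoly_mx_const m p (M : 'M[C]_(m, p)) : tpoly_mx (fun=> M).
Proof. by move=> i j; exact: tpoly_const. Qed.

Lemma tpoly_mxD m p (M N : C -> 'M[C]_(m, p)) :
  tpoly_mx M -> tpoly_mx N -> tpoly_mx (fun w => M w + N w).
Proof. by move=> hM hN i j; under eq_fun do rewrite mxE; exact: tpolyD. Qed.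

Lemma tpoly_mxZ m p f (M : C -> 'M[C]_(m, p)) :
  tpoly f -> tpoly_mx M -> tpoly_mx (fun w => f w *: M w).
Proof. by move=> hf hM i j; under eq_fun do rewrite mxE; exact: tpolyM. Qed.

Lemma tpoly_mxM m p l (M : C -> 'M[C]_(m, p)) (N : C -> 'M[C]_(p, l)) :
  tpoly_mx M -> tpoly_mx N -> tpoly_mx (fun w => M w *m N w).
Proof.
move=> hM hN i j; under eq_fun do rewrite mxE.
by apply: tpoly_sum => k; exact: tpolyM.
Qed.

Lemma tpoly_mx_ctr m p (M : C -> 'M[C]_(m, p)) : tpoly_mx M -> tpoly_mx (fun w => ctr (M w)).
Proof. by move=> hM i j; under eq_fun do rewrite !mxE; exact: tpoly_conj. Qed.

Lemma tpoly_det m (M : C -> 'M[C]_m) : tpoly_mx M -> tpoly (fun w => \det (M w)).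
Proof.
move=> hM; apply: tpoly_sum => s; apply: tpolyM; first exact: tpoly_const.
by apply: tpoly_prod => i; exact: hM.
Qed.

Lemma tpoly_adj m (M : C -> 'M[C]_m) : tpoly_mx M -> tpoly_mx (fun w => \adj (M w)).
Proof.
move=> hM i j; under eq_fun do rewrite mxE.
apply: tpolyM; first exact: tpoly_const.
by apply: tpoly_det => k l; under eq_fun do rewrite !mxE; exact: hM.
Qed.

Lemma tpoly_mx_bounded m p (M : C -> 'M[C]_(m, p)) : tpoly_mx M ->
  exists2 c : R, 0 < c & forall w x, `|w| = 1 -> nsqC (M w *m x) <= c * nsqC x.
Proof.
move=> hM; have hi i : exists c : 'I_p -> R, forall j w, `|w| = 1 -> csq (M w i j) <= c j.
  by have [c hc] := boolp.choice (fun j => tpoly_bounded (hM i j)); exists c.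
have [F hF] := boolp.choice hi.
exists (1 + `|\sum_i (2 ^ size (index_enum 'I_p))%:R * \sum_j F i j|) => [|w x w1].
  by rewrite ltr_pwDl.
apply: (le_trans (nsqC_mulmx_le _ _)); rewrite ler_wpM2r ?nsqC_ge0 //.
apply: ler_wpDl => //; apply: le_trans (ler_norm _); apply: ler_sum => i _.
by rewrite ler_wpM2l //; apply: ler_sum => j _; exact: hF.
Qed.

End TrigonometricPolynomials.

(** * An inequality for positive semidefinite matrices *)

Section Positivity.
Variable R : realType.
Local Notation C := R[i].

Lemma ReD (x y : C) : complex.Re (x + y) = complex.Re x + complex.Re y.
Proof. by case: x y => [a b] [c d]. Qed.

Lemma Re_sum (I : Type) (r : seq I) (F : I -> C) :
  complex.Re (\sum_(i <- r) F i) = \sum_(i <- r) complex.Re (F i).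
Proof. by elim: r => [|i r ih]; rewrite ?big_nil // !big_cons ReD ih. Qed.

Lemma ReZ (s : R) (x : C) : complex.Re (s%:C%C * x) = s * complex.Re x.
Proof. by case: x => [a b] /=; rewrite mul0r subr0. Qed.

Lemma Re_real (s : R) : complex.Re s%:C%C = s.
Proof. by []. Qed.

Lemma Re_ses1_le m (x y : 'cV[C]_m) : complex.Re (ses 1%:M x y) <= nsqC x + nsqC y.
Proof.
rewrite /ses mulmx1 mxE Re_sum -big_split; apply: ler_sum => i _ /=; rewrite !mxE /csq.
case: (x i 0) (y i 0) => [a b] [c d] /=.
have := sqr_ge0 (a - c); have := sqr_ge0 (b - d); nra.
Qed.

(** Positivity is tested at u - s M u. With y = M u this gives q - 2 s |y|^2 + s^2 y'My >= 0, where
    y'My <= |y|^2 + |M y|^2 <= (1 + c) |y|^2, and s = 1/(1 + c) yields the claim without a spectral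
    decomposition. *)
Lemma psd_mulmx_le m (M : 'M[C]_m) (c : R) : ctr M = M -> psdC M -> 0 < c ->
  (forall x, nsqC (M *m x) <= c * nsqC x) ->
  forall u, nsqC (M *m u) <= (1 + c) * complex.Re (qformC M u).
Proof.
move=> hM pM c0 hc u; set y := M *m u.
have uy : ses M u y = (nsqC y)%:C%C.
  by rewrite -ses1 /ses mulmx1 /y ctrM hM.
have yu : ses M y u = (nsqC y)%:C%C.
  by rewrite -ses1 /ses mulmx1 -mulmxA.
have yy : complex.Re (ses M y y) <= (1 + c) * nsqC y.
  have -> : ses M y y = ses 1%:M y (M *m y) by rewrite /ses mulmx1 mulmxA.
  by apply: (le_trans (Re_ses1_le _ _)); have := hc y; lra.
pose s : R := (1 + c)^-1; have s0 : 0 < s by rewrite invr_gt0; lra.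
have sc : s * (1 + c) = 1 by rewrite mulVf // gt_eqF //; lra.
have := pM (u + ((- s)%:C)%C *: y); rewrite -[qformC M _]/(ses M _ _).
rewrite sesDl !sesDr !sesZl !sesZr uy yu conjc_real.
rewrite lecE => /andP[_]; rewrite !(ReD, ReZ, Re_real).
rewrite -[complex.Re (ses M u u)]/(complex.Re (qformC M u)).
have := nsqC_ge0 y.
move: (complex.Re (qformC M u)) (complex.Re (ses M y y)) yy => q Y.
move: (nsqC y) => N YN N0 h.
have h1 := ler_wpM2l (ltW (mulr_gt0 s0 s0)) YN.
have e1 : s * s * ((1 + c) * N) = s * N by rewrite mulrA -(mulrA s) sc mulr1.
have h2 : s * N <= q by lra.
have c1 : 0 <= 1 + c by lra.
have := ler_wpM2l c1 h2; rewrite mulrA (mulrC _ s) sc mul1r; exact.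
Qed.

End Positivity.

(** * Lower bound for the Popov matrix on the circle *)

Section FrequencyBound.
Variable R : realType.
Local Notation C := R[i].

(* Dividing out the zeros outside the closed disc only costs a constant on the circle. *)
Lemma circle_zeros (rs : seq C) :
  exists2 rs' : seq C, all (fun r => `|r| <= 1) rs' &
  exists2 k : R, 0 < k & forall w, `|w| = 1 ->
    k * csq (\prod_(r <- rs') (1 - r * w^-1)) <= csq (\prod_(r <- rs) (w - r)).
Proof.
elim: rs => [|r rs [rs' h [k k0 hk]]].
  by exists [::] => //; exists 1 => // w _; rewrite !big_nil mul1r.
have csqw w : `|w| = 1 -> csq (w - r) = csq (1 - r * w^-1).
  move=> w1; have w0 : w != 0 by rewrite -normr_eq0 w1 oner_eq0.
  have -> : w - r = w * (1 - r * w^-1) by rewrite mulrBr mulr1 mulrCA divff // mulr1.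
  by rewrite csqM (proj2 (csq1P w) w1) mul1r.
have [r1|r1] := boolP (`|r| <= 1).
  exists (r :: rs'); first by rewrite /= r1.
  exists k => // w w1; rewrite !big_cons !csqM csqw // mulrCA ler_wpM2l ?csq_ge0 //.
  exact: hk.
have {}r1 : 1 < `|r| by rewrite real_ltNge ?normr_real ?real1.
exists rs' => //; exists (csq (`|r| - 1) * k).
  rewrite mulr_gt0 // lt_neqAle csq_ge0 andbT eq_sym; apply/eqP => /csq_eq0/eqP.
  by rewrite subr_eq0 gt_eqF.
move=> w w1; rewrite big_cons csqM -mulrA.
have h1 : csq (`|r| - 1) <= csq (w - r).
  rewrite -lecR !csqE ler_sqr ?nnegrE ?normr_ge0 // -(distrC r).
  rewrite ger0_norm ?subr_ge0 ?(ltW r1) // -w1; exact: lerB_dist.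
apply: (le_trans (ler_wpM2l (csq_ge0 _) (hk _ w1))).
by rewrite ler_wpM2r ?csq_ge0.
Qed.

Variables (n m p : nat).
Variables (A : 'M[R]_n) (B : 'M[R]_(n, m)) (D : 'M[R]_(p, n)) (E : 'M[R]_(p, m)).
Variable Q : 'M[R]_p.

Definition spectrum (w : C) : 'M[C]_m :=
  ctr (transfer A B D E w) *m cmx Q *m transfer A B D E w.

Hypotheses (sA : schur A) (sQ : Q^T = Q).
Hypothesis psd : forall w, `|w| = 1 -> psdC (spectrum w).

Let chi (w : C) := \det (w%:M - cmx A).
(** The adjugate replaces the inverse, so that [N] is the transfer function with its denominator
    [chi] cleared. [H] is then a matrix of trigonometric polynomials that differs from [spectrum]
    only by the positive factor |chi|^2. *)
Let N (w : C) := cmx D *m (\adj (w%:M - cmx A) *m cmx B) + chi w *: cmx E.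
Let H (w : C) := ctr (N w) *m cmx Q *m N w.

Let N_transfer w : `|w| = 1 -> N w = chi w *: transfer A B D E w.
Proof.
move=> w1; have uw : w%:M - cmx A \in unitmx by apply: sA; rewrite w1.
have u0 : chi w \is a GRing.unit by rewrite -unitmxE.
rewrite /N /transfer /invmx uw scalerDr -[in RHS]scalemxAl -[in RHS]scalemxAr scalerA.
by rewrite divrr // scale1r.
Qed.

Let H_spectrum w : `|w| = 1 -> H w = (csq (chi w))%:C%C *: spectrum w.
Proof.
move=> w1; rewrite /H N_transfer // ctrZ -!scalemxAl -scalemxAr scalerA.
by rewrite csqE sqr_normc mulrC.
Qed.

Let tpoly_shift : tpoly_mx (fun w : C => w%:M - cmx A).
Proof.
apply: tpoly_mxD; last exact: tpoly_mx_const.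
move=> i j; under eq_fun do rewrite mxE -mulr_natr.
by apply: tpolyM; [exact: tpoly_id|exact: tpoly_const].
Qed.

Let tpoly_chi : tpoly chi.
Proof. exact: tpoly_det tpoly_shift. Qed.

Let tpoly_H : tpoly_mx H.
Proof.
have hN : tpoly_mx N.
  apply: tpoly_mxD; last by apply: tpoly_mxZ; [exact: tpoly_chi|exact: tpoly_mx_const].
  apply: tpoly_mxM; first exact: tpoly_mx_const.
  by apply: tpoly_mxM; [exact: tpoly_adj tpoly_shift|exact: tpoly_mx_const].
apply: (tpoly_mxM _ hN); apply: tpoly_mxM; last exact: tpoly_mx_const.
exact: tpoly_mx_ctr hN.
Qed.

Let H_psd w : `|w| = 1 -> psdC (H w).
Proof.
move=> w1 u; rewrite -[qformC _ _]/(ses _ _ _) H_spectrum // /ses -scalemxAr -scalemxAl mxE.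
by rewrite mulr_ge0 ?ler0c ?csq_ge0 //; exact: psd.
Qed.

Let H_herm w : ctr (H w) = H w.
Proof. by rewrite /H !ctrM ctrK ctr_cmx sQ mulmxA. Qed.

(** Since adj(H) H = det(H), one gets |det H|^2 |u|^2 <= c1 |H u|^2, where [c1] bounds the adjugate;
    [psd_mulmx_le] turns |H u|^2 into the quadratic form of [H], and a bound on |chi|^2 returns to
    [spectrum]. The numbers in [rs] come from the roots of the polynomial representing det H, which
    is nonzero at z0. *)
Lemma frequency_bound z0 : `|z0| = 1 -> pdC (spectrum z0) ->
  exists2 rs : seq C, all (fun r => `|r| <= 1) rs &
  exists2 k : R, 0 < k & forall w u, `|w| = 1 ->
    k * csq (\prod_(r <- rs) (1 - r * w^-1)) * nsqC u <= complex.Re (qformC (spectrum w) u).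
Proof.
move=> z01 pdz.
have [P [d hP]] := tpoly_det tpoly_H.
have P0 : P != 0.
  apply/eqP => P0; have := hP z0 z01; rewrite P0 horner0 => /eqP.
  have z00 : z0 != 0 by rewrite -normr_eq0 z01 oner_eq0.
  rewrite mulf_eq0 expf_eq0 (negbTE z00) andbF orbF -[_ == 0]negbK -unitfE -unitmxE.
  apply/negP; rewrite negbK H_spectrum // unitmxE detZ unitrM unitrX -?unitmxE.
    apply/mulmx_inj_unitmx => x Sx; apply: contrapT => /eqP /pdz.
    by rewrite /qformC -mulmxA Sx mulmx0 mxE ltxx.
  have : chi z0 \is a GRing.unit by rewrite -unitmxE; apply: sA; rewrite z01.
  rewrite !unitfE; apply: contra => /eqP h; apply/eqP; apply: csq_eq0.
  exact: (congr1 (@complex.Re R) h).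
have [rs0 EP] := closed_field_poly_normal P.
have [rs hrs [k0 k00 hk]] := circle_zeros rs0.
have [c1 c10 h1] := tpoly_mx_bounded (tpoly_adj tpoly_H).
have [c2 c20 h2] := tpoly_mx_bounded tpoly_H.
have [c3 h3] := tpoly_bounded tpoly_chi.
pose c4 := 1 + `|c3|; have c40 : 0 < c4 by rewrite ltr_pwDl.
have l0 : 0 < csq (lead_coef P).
  rewrite lt_neqAle csq_ge0 andbT eq_sym; apply/eqP => /csq_eq0/eqP.
  by rewrite lead_coef_eq0 (negbTE P0).
pose K := c1 * (1 + c2) * c4; have K0 : 0 < K by rewrite !mulr_gt0 //; lra.
exists rs => //; exists (K^-1 * (csq (lead_coef P) * k0)) => [|w u w1].
  by rewrite !mulr_gt0 // invr_gt0.
rewrite -(ler_pM2l K0) !mulrA mulfV ?gt_eqF // mul1r.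
have qS : 0 <= complex.Re (qformC (spectrum w) u).
  by have := psd w1 u; rewrite lecE => /andP[].
have e1 : complex.Re (qformC (H w) u) <= c4 * complex.Re (qformC (spectrum w) u).
  rewrite -[qformC _ _]/(ses _ _ _) H_spectrum // /ses -scalemxAr -scalemxAl mxE ReZ.
  rewrite -[(_ *m u) 0 0]/(qformC (spectrum w) u) ler_wpM2r //.
  by apply: (le_trans (h3 w w1)); rewrite /c4 ler_wpDl // ler_norm.
have e2 := psd_mulmx_le (H_herm w) (H_psd w1) c20 (fun x => h2 w x w1) u.
have e3 : csq (\det (H w)) * nsqC u <= c1 * nsqC (H w *m u).
  by have := h1 w (H w *m u) w1; rewrite mulmxA mul_adj_mx mul_scalar_mx nsqCZ.
have e4 : csq (\det (H w)) = csq (lead_coef P) * csq (\prod_(r <- rs0) (w - r)).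
  have cw : csq (w ^+ d) = 1 by apply/csq1P; rewrite normrX w1 expr1n.
  rewrite -[LHS]mulr1 -cw -csqM hP // {1}EP hornerZ csqM horner_prod; congr (_ * csq _).
  by apply: eq_bigr => r _; rewrite hornerXsubC.
have e5 : csq (lead_coef P) * k0 * csq (\prod_(r <- rs) (1 - r * w^-1)) * nsqC u
    <= csq (\det (H w)) * nsqC u.
  by rewrite ler_wpM2r ?nsqC_ge0 // e4 -mulrA ler_pM2l // hk.
apply: (le_trans e5); apply: (le_trans e3); rewrite /K -!mulrA ler_pM2l //.
by apply: (le_trans e2); rewrite ler_wpM2l //; lra.
Qed.

End FrequencyBound.

(** * Continuity of the pairing in both arguments *)

Section Approximation.
Variables (R : realType) (m p : nat) (Q : 'M[R]_(m, p)).

(** The approximants are controlled on the window [0, T) only, because the periodic responses to be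
    inserted for them are not square summable. *)
Lemma l2S_partial_approx (f : nat -> 'cV[R]_m) (g : nat -> 'cV[R]_p) (eta : R) :
  l2 m f -> l2 p g -> 0 < eta ->
  exists2 d : R, 0 < d & exists T1, forall T, (T1 <= T)%N ->
      forall (f' : nat -> 'cV[R]_m) (g' : nat -> 'cV[R]_p),
    \sum_(t < T) sqn (f' t - f t) <= d -> \sum_(t < T) sqn (g' t - g t) <= d ->
    `|\sum_(t < T) bil Q (f' t) (g' t) - l2S Q f g| <= eta.
Proof.
move=> lf lg eta0; have q0 := mxabs_gt0 Q; set q := mxabs Q in q0.
have Y0 : 0 < l2N f + l2N g + 1 by have := l2N_ge0 lf; have := l2N_ge0 lg; lra.
(* The difference splits into two terms linear in the errors and one quadratic term. [e] makes the
   part carrying |f|^2 + |g|^2 at most eta/4, then [d] does the same for the part carrying the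
   errors; the tail of the series takes the remaining eta/2. *)
pose e := eta / (4 * q * (l2N f + l2N g + 1)).
have e0 : 0 < e by rewrite divr_gt0 // !mulr_gt0.
have ei : 0 < e^-1 by rewrite invr_gt0.
pose d := eta / (8 * q * (e^-1 + 1)).
have d0 : 0 < d by rewrite divr_gt0 // !mulr_gt0 //; lra.
exists d => //.
have /cvgrPdist_le/(_ (eta / 2)) := l2S_cvg Q lf lg.
have eta2 : 0 < eta / 2 by lra.
move=> /(_ eta2)[T1 _ hT1]; exists T1 => T T1T f' g' hf hg.
have := hT1 T T1T; rewrite /= -/(l2S Q f g) /series /= big_mkord distrC => h1.
have h2 : `|\sum_(t < T) bil Q (f' t) (g' t) - \sum_(t < T) bil Q (f t) (g t)| <= eta / 2.
  rewrite -sumrB; apply: (le_trans (ler_norm_sum _ _ _)).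
  apply: (@le_trans _ _ (\sum_(t < T) q * (e * sqn (f t) + e * sqn (g t) +
     (e^-1 + 1) * (sqn (f' t - f t) + sqn (g' t - g t))))).
    apply: ler_sum => t _.
    have -> : bil Q (f' t) (g' t) - bil Q (f t) (g t) = bil Q (f t) (g' t - g t) +
       bil Q (f' t - f t) (g t) + bil Q (f' t - f t) (g' t - g t).
      rewrite -{1}(subrK (f t) (f' t)) -{1}(subrK (g t) (g' t)).
      by move: (f' t - f t) (g' t - g t) => x y; rewrite bilDl !bilDr; ring.
    have b1 := bil_le Q (f t) (g' t - g t) e0.
    have b2 := bil_le Q (f' t - f t) (g t) ei; rewrite invrK in b2.
    have b3 := bil_le Q (f' t - f t) (g' t - g t) (@ltr01 R); rewrite invr1 in b3.
    apply: (le_trans (ler_normD _ _)); apply: (le_trans (lerD (ler_normD _ _) (lexx _))).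
    by apply: (le_trans (lerD (lerD b1 b2) b3)); rewrite -/q; lra.
  rewrite -mulr_sumr !big_split /= -!mulr_sumr big_split /=.
  have hF := l2N_ge T lf; have hG := l2N_ge T lg.
  have e1 : q * (e * (l2N f + l2N g + 1)) = eta / 4.
    by rewrite /e; field; rewrite !gt_eqF.
  have e2 : q * ((e^-1 + 1) * d) = eta / 8.
    have x0 : 0 < e^-1 + 1 by lra.
    by rewrite /d; move: (e^-1 + 1) x0 => x x0; field; rewrite !gt_eqF.
  have k1 : e * (\sum_(t < T) sqn (f t)) + e * \sum_(t < T) sqn (g t) <= e * (l2N f + l2N g + 1).
    rewrite -mulrDr ler_pM2l //; lra.
  have k2 : (e^-1 + 1) * (\sum_(t < T) sqn (f' t - f t) + \sum_(t < T) sqn (g' t - g t))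
      <= 2 * ((e^-1 + 1) * d).
    rewrite mulrCA ler_pM2l; lra.
  have := lerD k1 k2; rewrite -(ler_pM2l q0) => /le_trans; apply.
  by rewrite mulrDr e1 mulrCA e2; lra.
rewrite -[X in X - _](subrK (\sum_(t < T) bil Q (f t) (g t))) -addrA.
by apply: (le_trans (ler_normD _ _)); rewrite [leRHS](splitr eta) lerD.
Qed.

Lemma l2S_approx (f : nat -> 'cV[R]_m) (g : nat -> 'cV[R]_p) (eta : R) :
  l2 m f -> l2 p g -> 0 < eta ->
  exists2 d : R, 0 < d & forall f' g', l2 m f' -> l2 p g' ->
    l2N (f' - f) <= d -> l2N (g' - g) <= d -> `|l2S Q f' g' - l2S Q f g| <= eta.
Proof.
move=> lf lg eta0; have [d d0 [T1 h]] := l2S_partial_approx lf lg eta0.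
have lB m' (f1 f2 : nat -> 'cV[R]_m') : l2 m' f1 -> l2 m' f2 -> l2 m' (f1 - f2).
  by move=> l1 l2'; rewrite -scaleN1r; exact: l2_linear.
exists d => // f' g' lf' lg' hf hg.
have {}h T : (T1 <= T)%N ->
    l2S Q f g - eta <= series (fun t => bil Q (f' t) (g' t)) T <= l2S Q f g + eta.
  move=> T1T; rewrite /series /= big_mkord -ler_distl; apply: h => //.
    by apply: le_trans hf; exact: l2N_ge (lB _ _ _ lf' lf).
  by apply: le_trans hg; exact: l2N_ge (lB _ _ _ lg' lg).
rewrite ler_distl; apply/andP; split.
  apply: limr_ge; first exact: l2S_cvg.
  by exists T1 => // T /= /h /andP[].
apply: limr_le; first exact: l2S_cvg.
by exists T1 => // T /= /h /andP[].
Qed.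

End Approximation.

(** * The Stein equation and the influence of the initial state *)

Section Stein.
Variables (R : realType) (n : nat) (A : 'M[R]_n).
Hypothesis sA : schur A.

(** By finite dimension injectivity of P -> P - A'PA suffices. If P = A'PA, then x'Py equals (A^t
    x)' P (A^t y) for every t, and these values are absolutely summable, hence zero. *)
Lemma stein_exists (W : 'M[R]_n) : exists P : 'M[R]_n, P - A^T *m P *m A = W.
Proof.
pose L := lin_mx (idfun \- (mulmxr A \o mulmx A^T)) : 'M[R]_(n * n).
have LE P : mxvec P *m L = mxvec (P - A^T *m P *m A) by rewrite mul_vec_lin.
suff uL : L \in unitmx.
  exists (vec_mx (mxvec W *m invmx L)); apply: (can_inj mxvecK).
  by rewrite -LE vec_mxK mulmxKV.
rewrite -row_free_unit -kermx_eq0; apply/rowV0P => v /sub_kermxP.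
rewrite -[v]vec_mxK LE; move: (vec_mx v) => P /(congr1 vec_mx); rewrite mxvecK linear0.
move=> /eqP; rewrite subr_eq0 => /eqP PE.
have [c c0 hc] := expmx_energy sA.
have it x y t : bil P x y = bil P (expmx A t *m x) (expmx A t *m y).
  elim: t => [|t ->]; first by rewrite !mul1mx.
  by rewrite {1}PE /bil /= !trmx_mul !mulmxA.
have P0 x y : bil P x y = 0.
  pose K := mxabs P * (c * sqn x + c * sqn y).
  have h T : T%:R * `|bil P x y| <= K.
    rewrite mulr_natl -[T in _ *+ T]card_ord -sumr_const.
    apply: (@le_trans _ _ (\sum_(t < T) mxabs P * (sqn (expmx A t *m x) + sqn (expmx A t *m y)))).
      apply: ler_sum => t _; rewrite (it _ _ t).
      by have := bil_le P (expmx A t *m x) (expmx A t *m y) ltr01; rewrite invr1 !mul1r.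
    rewrite -mulr_sumr big_split /= ler_wpM2l ?(ltW (mxabs_gt0 _)) //.
    by apply: lerD; exact: hc.
  apply/eqP; rewrite -normr_le0 leNgt; apply/negP => b0.
  have := h (Num.truncn (K / `|bil P x y|)).+1; apply/negP; rewrite -ltNge.
  by rewrite -ltr_pdivrMr // truncnS_gt.
rewrite (_ : P = 0) ?linear0 //; apply/matrixP => i j; rewrite mxE.
have := P0 (delta_mx i 0) (delta_mx j 0).
by rewrite /bil trmx_delta -rowE -colE !mxE.
Qed.

Variables (m p : nat) (B : 'M[R]_(n, m)) (D : 'M[R]_(p, n)) (E : 'M[R]_(p, m)).
Variable Q : 'M[R]_p.

(** With P - A'PA = D'QD, the forced state x drops out of the cross term up to the telescoping
    difference of a(t)'P x(t), which vanishes at t = 0 because the motion starts from rest and tends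
    to 0 at infinity. What remains pairs the free motion with the input directly, the form on which
    filters can act. *)
Lemma free_output_functional : exists K : 'M[R]_(n, m), forall x0 u, l2 m u ->
  l2S Q (fun t => D *m (expmx A t *m x0)) (output A B D E u) =
  l2S K (fun t => expmx A t *m x0) u.
Proof.
have [P PE] := stein_exists (D^T *m Q *m D).
exists (A^T *m P *m B + D^T *m Q *m E) => x0 u lu.
have lB := l2_mulmx B lu; have lx := l2_state sA 0 lB; set x := state A 0 _ in lx.
have lf := l2_free sA x0; set a := fun t => expmx A t *m x0 in lf *.
have a_S t : a t.+1 = A *m a t by rewrite /a /= mulmxA.
have step t : bil Q (D *m a t) (output A B D E u t) =
   bil (A^T *m P *m B + D^T *m Q *m E) (a t) (u t) + (bil P (a t) (x t) - bil P (a t.+1) (x t.+1)).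
  have -> : bil P (a t.+1) (x t.+1) = bil (A^T *m P *m A) (a t) (x t) + bil (A^T *m P *m B) (a t) (u t).
    rewrite a_S [x t.+1]/(A *m x t + B *m u t) bilDr /bil !trmx_mul !mulmxA.
    by [].
  have -> : bil Q (D *m a t) (output A B D E u t) =
      bil (D^T *m Q *m D) (a t) (x t) + bil (D^T *m Q *m E) (a t) (u t).
    by rewrite /output -/x bilDr /bil !trmx_mul !mulmxA.
  rewrite -PE !bilD bilN; ring.
have bP : (fun t => bil P (a t) (x t)) @ \oo --> (0 : R).
  by apply: cvg_series_cvg_0; exact: l2S_cvg.
apply: cvg_lim => //.
have -> : series (fun t => bil Q (D *m a t) (output A B D E u t)) =
   (fun T => series (fun t => bil (A^T *m P *m B + D^T *m Q *m E) (a t) (u t)) T - bil P (a T) (x T)).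
  apply/funext => T; rewrite /series /= !big_mkord.
  elim: T => [|T ih]; first by rewrite !big_ord0 /bil mulmx0 mxE subr0.
  by rewrite !big_ord_recr ih step /=; ring.
rewrite -[l2S _ _ _]subr0; apply: cvgB => //; exact: l2S_cvg.
Qed.

End Stein.

(** * Filtering the input against the free motion *)

Section Filters.
Variables (R : realType) (n m : nat) (A : 'M[R]_n).
Local Notation C := R[i].

(** No conjugation: the complex scalar r has to pass unchanged from the input to the initial
    state. *)
Definition bilC k l (M : 'M[C]_(k, l)) (x : 'cV[C]_k) (y : 'cV[C]_l) : C := (x^T *m M *m y) 0 0.

Lemma bilCBl k l (M : 'M[C]_(k, l)) x1 x2 y : bilC M (x1 - x2) y = bilC M x1 y - bilC M x2 y.
Proof. by rewrite /bilC linearB !mulmxBl !mxE. Qed.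
Lemma bilCBr k l (M : 'M[C]_(k, l)) x y1 y2 : bilC M x (y1 - y2) = bilC M x y1 - bilC M x y2.
Proof. by rewrite /bilC mulmxBr !mxE. Qed.
Lemma bilCZl k l (M : 'M[C]_(k, l)) s x y : bilC M (s *: x) y = s * bilC M x y.
Proof. by rewrite /bilC linearZ -!scalemxAl mxE. Qed.
Lemma bilCZr k l (M : 'M[C]_(k, l)) s x y : bilC M x (s *: y) = s * bilC M x y.
Proof. by rewrite /bilC -!scalemxAr mxE. Qed.
Lemma bilC0r k l (M : 'M[C]_(k, l)) x : bilC M x 0 = 0.
Proof. by rewrite /bilC mulmx0 mxE. Qed.

Lemma bilC_cmx k l (M : 'M[R]_(k, l)) x y : bilC (cmx M) (cmx x) (cmx y) = (bil M x y)%:C%C.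
Proof.
have tr : (cmx x)^T = cmx x^T by apply/matrixP => i j; rewrite !mxE.
by rewrite /bilC tr -!cmxM mxE.
Qed.

Lemma Re_bilC_ge k l (M : 'M[C]_(k, l)) x y (e : R) : 0 < e ->
  - (e^-1 * nsqC x + e * nsqC (M *m y)) <= complex.Re (bilC M x y).
Proof.
move=> e0; rewrite /bilC -mulmxA; move: (M *m y) => {}y.
rewrite mxE Re_sum /nsqC !mulr_sumr -big_split -sumrN; apply: ler_sum => i _ /=.
rewrite mxE /csq; case: (x i 0) (y i 0) => [a b] [c d] /=.
have ei : 0 < e^-1 by rewrite invr_gt0.
have := young a c ei; have := young b d ei; rewrite !invrK !ler_norml.
by move=> /andP[h1 h2] /andP[h3 h4]; lra.
Qed.

Definition delay (v : nat -> 'cV[C]_m) t : 'cV[C]_m := if t is t'.+1 then v t' else 0.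

Definition pairing (M : 'M[C]_(n, m)) T (a : 'cV[C]_n) (v : nat -> 'cV[C]_m) : C :=
  \sum_(t < T) bilC M (cmx (expmx A t) *m a) (v t).

(** A shift of the summation index moves one power of A into a delay of v; both boundary terms
    vanish, since the delayed sequence starts with 0 and v(T) = 0. *)
Lemma pairing_filter M T r a v : v T = 0 ->
  pairing M T.+1 ((1%:M - r *: cmx A) *m a) v = pairing M T.+1 a (fun t => v t - r *: delay v t).
Proof.
move=> vT; rewrite /pairing.
have -> : \sum_(t < T.+1) bilC M (cmx (expmx A t) *m a) (v t - r *: delay v t) =
   \sum_(t < T.+1) bilC M (cmx (expmx A t) *m a) (v t) -
   r * \sum_(t < T.+1) bilC M (cmx (expmx A t) *m a) (delay v t).
  by rewrite mulr_sumr -sumrB; apply: eq_bigr => t _; rewrite bilCBr bilCZr.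
rewrite [X in _ = _ - _ * X]big_ord_recl /= bilC0r add0r !big_ord_recr /= vT !bilC0r !addr0.
rewrite mulr_sumr -sumrB; apply: eq_bigr => t _ /=.
rewrite mulmxA mulmxBr mulmx1 mulmxBl -scalemxAr -scalemxAl bilCBl bilCZl.
by rewrite -cmxM -expmxSr.
Qed.

Lemma dft_delay T v (w : C) : v T = 0 -> w ^+ T.+1 = 1 ->
  dft T.+1 (delay v) w = w^-1 *: dft T.+1 v w.
Proof.
move=> vT wT; rewrite /dft big_ord_recl /= scaler0 add0r big_ord_recr /= vT scaler0 addr0.
by rewrite scaler_sumr; apply: eq_bigr => t _; rewrite scalerA -exprS.
Qed.

Hypothesis sA : schur A.

Lemma schur_unit_factor r : `|r| <= 1 -> 1%:M - r *: cmx A \in unitmx.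
Proof.
move=> r1; have [->|r0] := eqVneq r 0; first by rewrite scale0r subr0 unitmx1.
have -> : 1%:M - r *: cmx A = r *: (r^-1%:M - cmx A).
  by rewrite scalerBr scale_scalar_mx divff.
rewrite unitmxZ ?unitfE //; apply: sA.
by rewrite normfV invf_ge1 // normr_gt0.
Qed.

(* The adjoint of the filter v |-> v - r (delay v) is 1 - r A on the initial states. *)
Lemma pairing_filters (M : 'M[C]_(n, m)) (rs : seq C) : all (fun r => `|r| <= 1) rs ->
  forall a, exists a', forall L T v, (forall t, (L <= t)%N -> v t = 0) -> (L + size rs <= T)%N ->
  exists2 v', pairing M T a v = pairing M T a' v' &
    forall w : C, w ^+ T = 1 -> dft T v' w = (\prod_(r <- rs) (1 - r * w^-1)) *: dft T v w.
Proof.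
elim: rs => [_ a|r rs ih /= /andP[r1 /ih{}ih] a].
  by exists a => L T v _ _; exists v => // w _; rewrite big_nil scale1r.
have ur := schur_unit_factor r1.
have [a' ha'] := ih (invmx (1%:M - r *: cmx A) *m a); exists a' => L [|T] v vL.
  by rewrite addnS.
rewrite addnS ltnS => LT; have vT : v T = 0 by apply: vL; rewrite (leq_trans (leq_addr _ _) LT).
(* Each delay lengthens the support by one, which is why the horizon must exceed [L] by the number
   of filters. *)
have [|//|v' hv hw] := ha' L.+1 T.+1 (fun t => v t - r *: delay v t).
- move=> [//|t]; rewrite ltnS => Lt /=; rewrite !vL ?scaler0 ?subr0 //.
  exact: leq_trans Lt _.
exists v' => [|w wT]; first by rewrite -hv -pairing_filter // mulKVmx.
rewrite hw // big_cons [X in _ = X *: _]mulrC -scalerA; congr (_ *: _).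
rewrite scalerBl scale1r -scalerA -dft_delay // /dft scaler_sumr -sumrB.
by apply: eq_bigr => t _; rewrite scalerBr !scalerA mulrC.
Qed.

End Filters.

Section Truncation.
Variables (R : realType) (n m p : nat).
Variables (A : 'M[R]_n) (B : 'M[R]_(n, m)) (D : 'M[R]_(p, n)) (E : 'M[R]_(p, m)).
Hypothesis sA : schur A.

Lemma output_trunc_approx u (d : R) : l2 m u -> 0 < d ->
  exists T, l2N (output A B D E (trunc T u) - output A B D E u) <= d.
Proof.
move=> lu d0; have [c c0 hc] := l2N_output B D E sA.
have [T hT] := trunc_approx lu (divr_gt0 d0 c0); exists T.
have lt := l2_trunc T u; have lb := l2_linear (-1) lu lt.
rewrite scaleN1r in lb.
have -> : output A B D E (trunc T u) - output A B D E u =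
    (-1) *: output A B D E (u - trunc T u).
  have := output_linear A B D E (-1) u (trunc T u); rewrite scaleN1r => ->.
  by rewrite !scaleN1r opprB.
rewrite l2NZ; last exact: l2_output.
rewrite sqrrN expr1n mul1r; apply: (le_trans (hc _ lb)).
by rewrite mulrC -ler_pdivlMr.
Qed.

End Truncation.

(** * Coupling inequality between the two inputs *)

Section TwoChannels.
Variables (R : realType) (n m1 m2 p : nat).
Variables (A : 'M[R]_n) (B1 : 'M[R]_(n, m1)) (B2 : 'M[R]_(n, m2)).
Variables (D : 'M[R]_(p, n)) (E1 : 'M[R]_(p, m1)) (E2 : 'M[R]_(p, m2)) (Q : 'M[R]_p) (eps : R).
Local Notation C := R[i].
Local Notation G1 := (transfer A B1 D E1).
Local Notation G2 := (transfer A B2 D E2).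
Local Notation y1 := (output A B1 D E1).
Local Notation y2 := (output A B2 D E2).

Hypotheses (sA : schur A) (eps0 : 0 < eps).
Hypothesis psd : forall w : C, `|w| = 1 -> forall u1 u2,
  0 <= ses (cmx Q) (G1 w *m u1) (G1 w *m u1)
     + eps%:C%C * (ses (cmx Q) (G1 w *m u1) (G2 w *m u2) + ses (cmx Q) (G2 w *m u2) (G1 w *m u1))
     - ses (cmx Q) (G2 w *m u2) (G2 w *m u2).

Let form f g := l2S Q f f + eps * (l2S Q f g + l2S Q g f) - l2S Q g g.

(** For periodic responses Parseval writes T times the form as a sum over T-th roots of unity of
    values of the weighted Popov form, each nonnegative by [psd]. The form of the true responses is
    the limit as T grows. *)
Lemma two_channels_finite L (v : nat -> 'cV[R]_m1) (w : nat -> 'cV[R]_m2) : (forall t, (L <= t)%N -> v t = 0) ->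
  (forall t, (L <= t)%N -> w t = 0) -> 0 <= form (y1 v) (y2 w).
Proof.
move=> vL wL.
have lf := (l2_output B1 D E1 sA (l2_finite L vL)).
have lg := (l2_output B2 D E2 sA (l2_finite L wL)).
apply/ler_addgt0Pl => eta' eta'0; pose eta := eta' / (2 + 2 * eps).
(* The four pairings enter with weights 1, eps, eps and 1, so errors of size [eta] add up to at most
   [eta']. *)
have eta0 : 0 < eta by rewrite divr_gt0 // addr_gt0 // mulr_gt0.
have [d1 d10 [T1 h1]] := l2S_partial_approx Q lf lf eta0.
have [d2 d20 [T2 h2]] := l2S_partial_approx Q lf lg eta0.
have [d3 d30 [T3 h3]] := l2S_partial_approx Q lg lf eta0.
have [d4 d40 [T4 h4]] := l2S_partial_approx Q lg lg eta0.
pose d := Num.min (Num.min d1 d2) (Num.min d3 d4).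
have d0 : 0 < d by rewrite !lt_min d10 d20 d30 d40.
have [Tv hv] := periodic_output B1 D E1 sA vL d0.
have [Tw hw] := periodic_output B2 D E2 sA wL d0.
pose s := [:: T1; T2; T3; T4; Tv; Tw]; pose T := (\max_(i <- s) i).+1.
have kT i : i \in s -> (i <= T)%N by move=> si; rewrite leqW // (@leq_bigmax_seq _ s xpredT id).
have [yv ev Yv] := hv T (kT _ (@mem_nth _ 0%N s 4 isT)).
have [yw ew Yw] := hw T (kT _ (@mem_nth _ 0%N s 5 isT)).
have {h1} := h1 T (kT _ (@mem_nth _ 0%N s 0 isT)) yv yv.
have {h2} := h2 T (kT _ (@mem_nth _ 0%N s 1 isT)) yv yw.
have {h3} := h3 T (kT _ (@mem_nth _ 0%N s 2 isT)) yw yv.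
have {h4} := h4 T (kT _ (@mem_nth _ 0%N s 3 isT)) yw yw.
have dle : [/\ d <= d1, d <= d2, d <= d3 & d <= d4] by rewrite !ge_min !lexx !orbT.
case: dle => dd1 dd2 dd3 dd4.
move=> /(_ (le_trans ew dd4) (le_trans ew dd4)) h4.
move=> /(_ (le_trans ew dd3) (le_trans ev dd3)) h3.
move=> /(_ (le_trans ev dd2) (le_trans ew dd2)) h2.
move=> /(_ (le_trans ev dd1) (le_trans ev dd1)) h1.
pose S (f g : nat -> 'cV[R]_p) := \sum_(t < T) bil Q (f t) (g t).
have [z pz] := prim_root_exists R (ltn0Sn (\max_(i <- s) i)).
have parseval (f g : nat -> 'cV[R]_p) : \sum_(j < T) ses (cmx Q) (dft T (fun t => cmx (f t)) (z ^+ j))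
    (dft T (fun t => cmx (g t)) (z ^+ j)) = (T%:R * S f g)%:C%C.
  rewrite dft_parseval // rmorphM rmorph_nat /S rmorph_sum; congr (_ * _).
  by apply: eq_bigr => t _; rewrite ses_cmx.
have pos : 0 <= S yv yv + eps * (S yv yw + S yw yv) - S yw yw.
  have Tp : 0 < T%:R :> R by rewrite ltr0n.
  have e : T%:R * (S yv yv + eps * (S yv yw + S yw yv) - S yw yw) = T%:R * S yv yv
      + eps * (T%:R * S yv yw + T%:R * S yw yv) - T%:R * S yw yw by ring.
  rewrite -(pmulr_rge0 _ Tp) -ler0c e.
  rewrite rmorphB rmorphD /= [(eps * _)%:C%C]rmorphM rmorphD /= -!parseval -big_split mulr_sumr -big_split -sumrB.
  apply: sumr_ge0 => j _ /=.
  have zj : (z ^+ j) ^+ T = 1 by rewrite -exprM mulnC exprM (prim_expr_order pz) expr1n.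
  rewrite Yv // Yw //; apply: psd; exact: (unity_root_norm (ltn0Sn _) zj).
move: h1 h2 h3 h4 pos; rewrite -/(S _ _) -/(S _ _) -/(S _ _) -/(S _ _) !ler_norml /form.
move=> /andP[a1 b1] /andP[a2 b2] /andP[a3 b3] /andP[a4 b4] pos.
have e1 : eta' = 2 * eta + 2 * (eps * eta) by rewrite /eta; field; rewrite gt_eqF // addr_gt0 // mulr_gt0.
have := ler_wpM2l (ltW eps0) a2; have := ler_wpM2l (ltW eps0) b2.
have := ler_wpM2l (ltW eps0) a3; have := ler_wpM2l (ltW eps0) b3.
lra.
Qed.

Lemma two_channels v w : l2 m1 v -> l2 m2 w -> 0 <= form (y1 v) (y2 w).
Proof.
move=> lv lw.
have lf := l2_output B1 D E1 sA lv.
have lg := l2_output B2 D E2 sA lw.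
apply/ler_addgt0Pl => eta' eta'0; pose eta := eta' / (2 + 2 * eps).
have eta0 : 0 < eta by rewrite divr_gt0 // addr_gt0 // mulr_gt0.
have [d1 d10 h1] := l2S_approx Q lf lf eta0.
have [d2 d20 h2] := l2S_approx Q lf lg eta0.
have [d3 d30 h3] := l2S_approx Q lg lf eta0.
have [d4 d40 h4] := l2S_approx Q lg lg eta0.
pose d := Num.min (Num.min d1 d2) (Num.min d3 d4).
have d0 : 0 < d by rewrite !lt_min d10 d20 d30 d40.
have dle : [/\ d <= d1, d <= d2, d <= d3 & d <= d4] by rewrite !ge_min !lexx !orbT.
case: dle => dd1 dd2 dd3 dd4.
have [Tv ev] := output_trunc_approx B1 D E1 sA lv d0.
have [Tw ew] := output_trunc_approx B2 D E2 sA lw d0.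
have lf' := l2_output B1 D E1 sA (l2_trunc Tv v).
have lg' := l2_output B2 D E2 sA (l2_trunc Tw w).
have := h1 _ _ lf' lf' (le_trans ev dd1) (le_trans ev dd1).
have := h2 _ _ lf' lg' (le_trans ev dd2) (le_trans ew dd2).
have := h3 _ _ lg' lf' (le_trans ew dd3) (le_trans ev dd3).
have := h4 _ _ lg' lg' (le_trans ew dd4) (le_trans ew dd4).
have pos : 0 <= form (y1 (trunc Tv v)) (y2 (trunc Tw w)).
  apply: (@two_channels_finite (Tv + Tw)) => t ht; rewrite /trunc ltnNge.
    by rewrite (leq_trans (leq_addr _ _) ht).
  by rewrite (leq_trans (leq_addl _ _) ht).
move: pos; rewrite !ler_norml /form.
move=> pos /andP[a1 b1] /andP[a2 b2] /andP[a3 b3] /andP[a4 b4].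
have e1 : eta' = 2 * eta + 2 * (eps * eta) by rewrite /eta; field; rewrite gt_eqF // addr_gt0 // mulr_gt0.
have := ler_wpM2l (ltW eps0) a2; have := ler_wpM2l (ltW eps0) b2.
have := ler_wpM2l (ltW eps0) a3; have := ler_wpM2l (ltW eps0) b3.
lra.
Qed.

End TwoChannels.

(** * Bound on the linear term caused by the initial state *)

Section OneChannel.
Variables (R : realType) (n m p : nat).
Variables (A : 'M[R]_n) (B : 'M[R]_(n, m)) (D : 'M[R]_(p, n)) (E : 'M[R]_(p, m)) (Q : 'M[R]_p).
Local Notation C := R[i].
Local Notation y := (output A B D E).

Hypotheses (sA : schur A) (sQ : Q^T = Q).
Hypothesis psd : forall w : C, `|w| = 1 -> psdC (spectrum A B D E Q w).
Variable z0 : C.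
Hypotheses (z01 : `|z0| = 1) (pd : pdC (spectrum A B D E Q z0)).

Lemma sum_nsqC_dft T (z : C) (v : nat -> 'cV[C]_m) : T.-primitive_root z ->
  T%:R * \sum_(t < T) nsqC (v t) = \sum_(j < T) nsqC (dft T v (z ^+ j)).
Proof.
move=> pz; apply: complexI; rewrite rmorphM rmorph_nat !rmorph_sum /=.
rewrite [RHS](eq_bigr (fun j : 'I_T => ses 1%:M (dft T v (z ^+ j)) (dft T v (z ^+ j)))); last first.
  by move=> j _; rewrite ses1.
by rewrite dft_parseval //; congr (_ * _); apply: eq_bigr => t _; rewrite ses1.
Qed.

(** The cross term becomes a pairing of A^t a' with the filtered input v', where a' depends on x0
    and the filters but not on u. The quadratic term is at least k times the energy of v', so
    Young's inequality absorbs the part in v' and leaves a constant. Truncation then passes from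
    finite inputs to all of l2. *)
Lemma one_channel (x0 : 'cV[R]_n) : exists c : R, forall u, l2 m u ->
  0 <= c + 2 * l2S Q (fun t => D *m (expmx A t *m x0)) (y u) + l2S Q (y u) (y u).
Proof.
have [rs hrs [k k0 hk]] := frequency_bound sA sQ psd z01 pd.
have [K hK] := free_output_functional sA B D E Q.
have [a' ha'] := pairing_filters sA (cmx K) hrs (cmx x0).
have [cA cA0 hcA] := schur_energyC sA; have [cK cK0 hcK] := nsqC_mulmx (cmx K).
(* This weight makes 2 e cK equal to k, so that twice the pairing costs exactly the available k
   times the energy of v'. *)
pose e := k / (2 * cK); have e0 : 0 < e by rewrite divr_gt0 // mulr_gt0.
pose c := 2 * (e^-1 * (cA * nsqC a')); exists c.
have lfree := l2_free sA x0.
have finite L (u : nat -> 'cV[R]_m) : (forall t, (L <= t)%N -> u t = 0) ->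
    0 <= c + 2 * l2S Q (fun t => D *m (expmx A t *m x0)) (y u) + l2S Q (y u) (y u).
  move=> uL; have lu := l2_finite L uL; have ly := l2_output B D E sA lu.
  rewrite hK //; apply/ler_addgt0Pl => eta' eta'0; pose eta := eta' / 3.
  have eta0 : 0 < eta by rewrite divr_gt0.
  have [d1 d10 [T1 h1]] := l2S_partial_approx K lfree lu eta0.
  have [d2 d20 [T2 h2]] := l2S_partial_approx Q ly ly eta0.
  have [T3 h3] := periodic_output B D E sA uL d20.
  pose s := [:: T1; T2; T3; L + size rs]%N; pose T := (\max_(i <- s) i).+1.
  have kT i : i \in s -> (i <= T)%N by move=> si; rewrite leqW // (@leq_bigmax_seq _ s xpredT id).
  have [yT eT YT] := h3 T (kT _ (@mem_nth _ 0%N s 2 isT)).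
  have {}h2 := h2 T (kT _ (@mem_nth _ 0%N s 1 isT)) yT yT eT eT.
  have {h1} := h1 T (kT _ (@mem_nth _ 0%N s 0 isT)) (fun t => expmx A t *m x0) u.
  have diff0 l (f : nat -> 'cV[R]_l) : \sum_(t < T) sqn (f t - f t) <= d1.
    by rewrite big1 ?(ltW d10) // => t _; rewrite subrr sqn0.
  move=> /(_ (diff0 _ (fun t => expmx A t *m x0)) (diff0 _ u)) h1.
  have uLC t : (L <= t)%N -> cmx (u t) = 0.
    by move=> Lt; rewrite uL //; apply/matrixP => i j; rewrite !mxE.
  have [v' hv hw] := ha' L T (fun t => cmx (u t)) uLC (kT _ (@mem_nth _ 0%N s 3 isT)).
  have [z pz] := prim_root_exists R (ltn0Sn (\max_(i <- s) i)).
  have Tp : 0 < T%:R :> R by rewrite ltr0n.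
  (* Parseval on both sides reduces this to the frequency bound at each root of unity: the transform
     of v' is the filter product times the transform of u. *)
  have v'_le : k * (\sum_(t < T) nsqC (v' t)) <= \sum_(t < T) bil Q (yT t) (yT t).
    rewrite -(ler_pM2l Tp) mulrCA (sum_nsqC_dft _ pz).
    have -> : T%:R * \sum_(t < T) bil Q (yT t) (yT t) =
       complex.Re (\sum_(j < T) ses (cmx Q) (dft T (fun t => cmx (yT t)) (z ^+ j))
         (dft T (fun t => cmx (yT t)) (z ^+ j))).
      rewrite dft_parseval // -(rmorph_nat (real_complex R)) ReZ Re_sum; congr (_ * _).
      by apply: eq_bigr => t _; rewrite ses_cmx.
    rewrite Re_sum mulr_sumr; apply: ler_sum => j _.
    have zj : (z ^+ j) ^+ T = 1 by rewrite -exprM mulnC exprM (prim_expr_order pz) expr1n.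
    have zj1 := unity_root_norm (ltn0Sn _) zj.
    rewrite hw // YT // nsqCZ mulrA; apply: (le_trans (hk _ _ zj1)).
    by rewrite /qformC /ses /spectrum ctrM !mulmxA.
  have pair_ge : - (c + k * \sum_(t < T) nsqC (v' t)) <=
      2 * \sum_(t < T) bil K (expmx A t *m x0) (u t).
    have -> : \sum_(t < T) bil K (expmx A t *m x0) (u t) =
        complex.Re (pairing A (cmx K) T a' v').
      rewrite -hv /pairing Re_sum; apply: eq_bigr => t _.
      by rewrite -cmxM bilC_cmx.
    have free_le : \sum_(t < T) nsqC (cmx (expmx A t) *m a') <= cA * nsqC a'.
      have st t : cmx (expmx A t.+1) *m a' = cmx A *m (cmx (expmx A t) *m a') + 0.
        by rewrite addr0 /= cmxM mulmxA.
      have := hcA (fun t => cmx (expmx A t) *m a') (fun=> 0) st T.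
      have -> : cmx (expmx A 0) = 1%:M by rewrite /cmx /= map_mx1.
      by rewrite mul1mx [X in _ + X]big1 ?addr0 // => t _; rewrite nsqC0.
    have : \sum_(t < T) - (e^-1 * nsqC (cmx (expmx A t) *m a') + e * (cK * nsqC (v' t)))
        <= complex.Re (pairing A (cmx K) T a' v').
      rewrite /pairing Re_sum; apply: ler_sum => t _.
      apply: le_trans (Re_bilC_ge _ _ _ e0); rewrite lerN2 lerD2l ler_pM2l //.
    rewrite sumrN big_split /= -!mulr_sumr.
    have ei : 0 < e^-1 by rewrite invr_gt0.
    have := free_le; rewrite -(ler_pM2l ei) /c.
    have -> : e * (cK * \sum_(t < T) nsqC (v' t)) = k / 2 * \sum_(t < T) nsqC (v' t).
      by rewrite /e; field; rewrite gt_eqF.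
    clear; lra.
  move: h1 h2; rewrite !ler_distl => /andP[a1 b1] /andP[a2 b2].
  have -> : eta' = 3 * eta by rewrite /eta; field.
  clear -a1 b1 a2 b2 pair_ge v'_le eta0; lra.
move=> u lu; have ly := l2_output B D E sA lu.
rewrite hK //; apply/ler_addgt0Pl => eta' eta'0; pose eta := eta' / 3.
have eta0 : 0 < eta by rewrite divr_gt0.
have lD := l2_mulmx D lfree.
have [d1 d10 h1] := l2S_approx Q lD ly eta0.
have [d2 d20 h2] := l2S_approx Q ly ly eta0.
have d0 : 0 < Num.min d1 d2 by rewrite lt_min d10.
have [T hT] := output_trunc_approx B D E sA lu d0.
have [t1 t2] : l2N (y (trunc T u) - y u) <= d1 /\ l2N (y (trunc T u) - y u) <= d2.
  by move: hT; rewrite le_min => /andP[].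
have lt := l2_output B D E sA (l2_trunc T u).
have := h1 _ _ lD lt; rewrite subrr.
have -> : l2N (0 : nat -> 'cV[R]_p) = 0.
  by have := l2NZ 0 ly; rewrite scale0r expr0n mul0r.
move=> /(_ (ltW d10) t1); have := h2 _ _ lt lt t2 t2.
have : 0 <= c + 2 * l2S Q (fun t => D *m (expmx A t *m x0)) (y (trunc T u))
     + l2S Q (y (trunc T u)) (y (trunc T u)).
  by apply: (@finite T) => t Tt; rewrite /trunc ltnNge Tt.
rewrite -(hK _ _ lu) !ler_distl => a3 /andP[a1 b1] /andP[a2 b2].
have -> : eta' = 3 * eta by rewrite /eta; field.
clear -a3 a1 b1 a2 b2 eta0; lra.
Qed.

End OneChannel.

(** * Scaling rules for pairings and outputs *)

Section Homogeneity.
Variable R : realType.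

Lemma l2S0l m p (Q : 'M[R]_(m, p)) g : l2S Q 0 g = 0.
Proof.
apply: cvg_lim => //; rewrite (_ : series _ = fun=> 0); first exact: cvg_cst.
apply/funext => T; rewrite /series /= big1 // => t _.
by rewrite /bil trmx0 !mul0mx mxE.
Qed.

Lemma l2SZ m p (Q : 'M[R]_(m, p)) s r f g : l2 m f -> l2 p g ->
  l2S Q (s *: f) (r *: g) = s * r * l2S Q f g.
Proof.
move=> lf lg; have Zl s' g' : l2 p g' -> l2S Q (s' *: f) g' = s' * l2S Q f g'.
  by move=> lg'; have := l2S_linl Q s' (@l2_0 R m) lf lg'; rewrite l2S0l !add0r.
have lrg : l2 p (r *: g).
  by have := l2_linear r (@l2_0 R p) lg; rewrite add0r.
rewrite Zl // -mulrA; congr (_ * _).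
have := l2S_linr Q (r - 1) lf lg lg; rewrite scalerBl scale1r addrC subrK => ->.
ring.
Qed.

Lemma l2SN m p (Q : 'M[R]_(m, p)) f g : l2 m f -> l2 p g -> l2S (- Q) f g = - l2S Q f g.
Proof.
move=> lf lg; apply: cvg_lim => //.
rewrite (_ : (fun t => _) = - (fun t => bil Q (f t) (g t))); last first.
  by apply/funext => t; rewrite /= bilN.
rewrite seriesN; apply: cvgN; exact: l2S_cvg.
Qed.

Lemma output0 n m p (A : 'M[R]_n) (B : 'M[R]_(n, m)) (D : 'M[R]_(p, n)) (E : 'M[R]_(p, m)) :
  output A B D E 0 = 0.
Proof.
by have := output_linear A B D E (-1) 0 0; rewrite !scaleN1r !subrr.
Qed.

Lemma outputZ n m p (A : 'M[R]_n) (B : 'M[R]_(n, m)) (D : 'M[R]_(p, n)) (E : 'M[R]_(p, m)) s u :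
  output A B D E (s *: u) = s *: output A B D E u.
Proof. by rewrite -[s *: u]add0r output_linear output0 add0r. Qed.

End Homogeneity.

(** * The cost as a quadratic saddle *)

Section Assembly.
Variables (R : realType) (n k q : nat) (A : 'M[R]_n).
Variables (B1 : 'M[R]_(n, k)) (B2 : 'M[R]_(n, q)) (Q : 'M[R]_(n + (k + q))).
Local Notation C := R[i].

(** With these three embeddings the stacked vector [x; v; w] is the sum of a free response and two
    zero-state outputs, one for each input, so that the general results on outputs apply with the
    weight [Q] unchanged. *)
Definition state_out : 'M[R]_(n + (k + q), n) := col_mx 1%:M 0.
Definition input1_out : 'M[R]_(n + (k + q), k) := col_mx 0 (col_mx 1%:M 0).
Definition input2_out : 'M[R]_(n + (k + q), q) := col_mx 0 (col_mx 0 1%:M).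

Local Notation D := state_out.
Local Notation E1 := input1_out.
Local Notation E2 := input2_out.
Local Notation G1 := (transfer A B1 D E1).
Local Notation G2 := (transfer A B2 D E2).

Lemma Pi_block z : Pi A B1 B2 Q z =
  block_mx (ctr (G1 z) *m cmx Q *m G1 z) (ctr (G1 z) *m cmx Q *m G2 z)
           (ctr (G2 z) *m cmx Q *m G1 z) (ctr (G2 z) *m cmx Q *m G2 z).
Proof.
have cD : cmx D = col_mx 1%:M 0 by rewrite /cmx map_col_mx map_mx1 map_mx0.
have cE1 : cmx E1 = col_mx 0 (col_mx 1%:M 0).
  by rewrite /cmx !map_col_mx map_mx1 !map_mx0.
have cE2 : cmx E2 = col_mx 0 (col_mx 0 1%:M).
  by rewrite /cmx !map_col_mx map_mx1 !map_mx0.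
have -> : Pi A B1 B2 Q z = ctr (row_mx (G1 z) (G2 z)) *m cmx Q *m row_mx (G1 z) (G2 z).
  rewrite /Pi; suff -> : col_mx (invmx (z%:M - cmx A) *m cmx (row_mx B1 B2)) 1%:M
    = row_mx (G1 z) (G2 z) by [].
  rewrite /transfer cD cE1 cE2 !mul_col_mx !mul1mx !mul0mx !add_col_mx !addr0 !add0r.
  rewrite -block_mxEh block_mxEv -block_mxEh -scalar_mx_block; congr col_mx.
  by rewrite /cmx map_row_mx mul_mx_row.
rewrite /ctr map_row_mx tr_row_mx mul_col_mx mul_col_row //.
Qed.

Lemma ses_mulmx m1 m2 p1 p2 (M : 'M[C]_(p1, p2)) (F : 'M[C]_(p1, m1)) (G : 'M[C]_(p2, m2)) u v :
  ses M (F *m u) (G *m v) = ses (ctr F *m M *m G) u v.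
Proof. by rewrite /ses ctrM !mulmxA. Qed.

Lemma qformC_Pi_eps (eps : R) z u1 u2 :
  qformC (Pi_eps eps (Pi A B1 B2 Q z)) (col_mx u1 u2) =
  ses (cmx Q) (G1 z *m u1) (G1 z *m u1)
  + eps%:C%C * (ses (cmx Q) (G1 z *m u1) (G2 z *m u2) + ses (cmx Q) (G2 z *m u2) (G1 z *m u1))
  - ses (cmx Q) (G2 z *m u2) (G2 z *m u2).
Proof.
rewrite /qformC /Pi_eps Pi_block block_mxKul block_mxKur block_mxKdl block_mxKdr.
rewrite !ses_mulmx /ses.
have -> : ctr (col_mx u1 u2) = row_mx (ctr u1) (ctr u2) by rewrite /ctr map_col_mx tr_col_mx.
move: (ctr (G1 z) *m _ *m _) (ctr (G1 z) *m _ *m _) (ctr (G2 z) *m _ *m _) => P12 P11 P21.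
move: (ctr (G2 z) *m _ *m _) => P22.
rewrite mul_row_block mul_row_col !mulmxDl -!scalemxAr -!scalemxAl mulmxN mulNmx.
move: (ctr u1 *m P11 *m u1) (ctr u1 *m P12 *m u2) (ctr u2 *m P21 *m u1) => M11 M12 M21.
by move: (ctr u2 *m P22 *m u2) => M22; rewrite !mxE; ring.
Qed.

Hypotheses (sA : schur A) (sQ : Q^T = Q).
Variables (eps : R) (z0 : C).
Hypotheses (eps0 : 0 < eps) (z01 : `|z0| = 1).
Hypothesis psd : forall z : C, `|z| = 1 -> psdC (Pi_eps eps (Pi A B1 B2 Q z)).
Hypothesis pd1 : pdC (ulsubmx (Pi A B1 B2 Q z0)).
Hypothesis nd2 : ndC (drsubmx (Pi A B1 B2 Q z0)).

Variable a : 'cV[R]_n.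
Local Notation yv := (output A B1 D E1).
Local Notation yw := (output A B2 D E2).
Let y0 := fun t => D *m (expmx A t *m a).
Let Y v w := y0 + yv v + yw w.

Lemma gfunE v w : gfun A B1 B2 Q a v w = l2S Q (Y v w) (Y v w).
Proof.
congr (limn (series _)); apply/funext => t; rewrite /sigma /bil.
suff -> : col_mx (traj A B1 B2 a v w t) (col_mx (v t) (w t)) = Y v w t by [].
have -> : traj A B1 B2 a v w t = expmx A t *m a + state A 0 (fun s => B1 *m v s) t
    + state A 0 (fun s => B2 *m w s) t.
  elim: t => [|t ih] /=; first by rewrite mul1mx !addr0.
  by rewrite ih !mulmxDr mulmxA !addrA; congr (_ + _); rewrite addrAC.
rewrite /Y /y0 !fctE /output /state_out /input1_out /input2_out.
by rewrite !mul_col_mx !mul1mx !mul0mx !(add_col_mx, addr0, add0r).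
Qed.

Let psd1 w : `|w| = 1 -> psdC (spectrum A B1 D E1 Q w).
Proof.
move=> w1 u; have := psd w1 (col_mx u 0); rewrite qformC_Pi_eps !mulmx0 !ses0r ses0l.
by rewrite addr0 mulr0 addr0 subr0 ses_mulmx.
Qed.

Let spectrumN w : spectrum A B2 D E2 (- Q) w = - spectrum A B2 D E2 Q w.
Proof. by rewrite /spectrum /cmx map_mxN mulmxN mulNmx. Qed.

Let qformCN m (M : 'M[C]_m) u : qformC (- M) u = - qformC M u.
Proof. by rewrite /qformC mulmxN mulNmx mxE. Qed.

Let psd2 w : `|w| = 1 -> psdC (spectrum A B2 D E2 (- Q) w).
Proof.
move=> w1 u; have := psd w1 (col_mx 0 u); rewrite qformC_Pi_eps !mulmx0 !ses0r ses0l.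
by rewrite addr0 mulr0 addr0 add0r spectrumN qformCN ses_mulmx.
Qed.

(** The maximizing channel is treated by the same one-channel bound with -Q, for which its spectrum
    is positive. The coupling field comes from [two_channels] applied to the scaled inputs s h and r
    j, and the larger of the two channel constants serves both players. *)
Lemma gfun_saddle : exists c,
  quadratic_saddle (l2 k) (l2 q) (gfun A B1 B2 Q a)
    (fun v w h => 2 * l2S Q (Y v w) (yv h)) (fun v w j => 2 * l2S Q (Y v w) (yw j))
    (fun h => l2S Q (yv h) (yv h)) (fun h j => l2S Q (yv h) (yw j))
    (fun j => - l2S Q (yw j) (yw j)) eps c.
Proof.
have pd1' : pdC (spectrum A B1 D E1 Q z0) by move: pd1; rewrite Pi_block block_mxKul.
have pd2' : pdC (spectrum A B2 D E2 (- Q) z0).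
  move=> u u0; rewrite spectrumN qformCN oppr_gt0.
  by have := nd2; rewrite Pi_block block_mxKdr; apply.
have sQN : (- Q)^T = - Q by rewrite linearN /= sQ.
have [c1 h1] := one_channel sA sQ psd1 z01 pd1' a.
have [c2 h2] := one_channel sA sQN psd2 z01 pd2' a.
have l0 : l2 (n + (k + q)) y0 := l2_mulmx D (l2_free sA a).
have lv v : l2 k v -> l2 _ (yv v) := @l2_output _ _ _ _ _ B1 D E1 sA v.
have lw w : l2 q w -> l2 _ (yw w) := @l2_output _ _ _ _ _ B2 D E2 sA w.
have lY v w : l2 k v -> l2 q w -> l2 (n + (k + q)) (Y v w).
  move=> /lv l1 /lw l2'; have := l2_linear 1 (l2_linear 1 l0 l1) l2'.
  by rewrite !scale1r.
have Y00 : Y 0 0 = y0 by rewrite /Y !output0 !addr0.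
exists (Num.max c1 c2); split.
- move=> v h w j s r Pv Ph Pw Pj; rewrite !gfunE.
  have -> : Y (v + s *: h) (w + r *: j) = Y v w + s *: yv h + r *: yw j.
    rewrite /Y !output_linear; move: (yv v) (yv h) (yw w) (yw j) => f1 f2 f3 f4.
    by rewrite !addrA; congr (_ + _); rewrite addrAC.
  have ly := lY _ _ Pv Pw; have lh := lv _ Ph; have lj := lw _ Pj.
  have ly' := l2_linear s ly lh; have ly'' := l2_linear r ly' lj.
  rewrite l2S_linl // !(l2S_linr _ _ _ ly' lj) // !l2S_linl // !(l2S_linr _ _ _ ly lh) //.
  rewrite (l2S_sym (yv h) (Y v w) sQ) (l2S_sym (yw j) (Y v w) sQ) (l2S_sym (yw j) (yv h) sQ).
  ring.
- move=> h j s r Ph Pj; have lh := lv _ Ph; have lj := lw _ Pj.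
  have lsh : l2 k (s *: h) by have := l2_linear s (@l2_0 R k) Ph; rewrite add0r.
  have lrj : l2 q (r *: j) by have := l2_linear r (@l2_0 R q) Pj; rewrite add0r.
  have := @two_channels _ _ _ _ _ A B1 B2 D E1 E2 Q eps sA eps0 _ _ _ lsh lrj.
  rewrite !outputZ !l2SZ // (l2S_sym (yw j) (yv h) sQ) => hh.
  have {hh} : 0 <= s * s * l2S Q (yv h) (yv h) + eps * (s * r * l2S Q (yv h) (yw j)
     + r * s * l2S Q (yv h) (yw j)) - r * r * l2S Q (yw j) (yw j).
    by apply: hh => w w1 u1 u2; rewrite -qformC_Pi_eps; exact: psd.
  by congr (0 <= _); ring.
- move=> h s Ph; have lh := lv _ Ph.
  have lsh : l2 k (s *: h) by have := l2_linear s (@l2_0 R k) Ph; rewrite add0r.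
  have e : l2S Q y0 (s *: yv h) = s * l2S Q y0 (yv h).
    by have := l2SZ Q 1 s l0 lh; rewrite scale1r mul1r.
  have := h1 _ lsh; rewrite -/y0 outputZ e l2SZ // Y00.
  have : c1 <= Num.max c1 c2 by rewrite le_max lexx.
  lra.
- move=> j r Pj; have lj := lw _ Pj.
  have lrj : l2 q (r *: j) by have := l2_linear r (@l2_0 R q) Pj; rewrite add0r.
  have e : l2S Q y0 (r *: yw j) = r * l2S Q y0 (yw j).
    by have := l2SZ Q 1 r l0 lj; rewrite scale1r mul1r.
  have lrw : l2 _ (r *: yw j).
    by have := l2_linear r (@l2_0 R _) lj; rewrite add0r.
  have := h2 _ lrj; rewrite -/y0 outputZ !l2SN // e l2SZ // Y00.
  have : c2 <= Num.max c1 c2 by rewrite le_max lexx orbT.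
  lra.
Qed.

End Assembly.

Unset Implicit Arguments.
Set Strict Implicit.
Set Printing Implicit Defensive.

Theorem theorem2p1 (R : realType) (n k q : nat) (A : 'M[R]_n)
  (B1 : 'M[R]_(n, k)) (B2 : 'M[R]_(n, q)) (Q : 'M[R]_(n + (k + q))) :
  schur A -> Q^T = Q ->
  (exists (eps : R) (z0 : R[i]), 0 < eps /\ `|z0| = 1 /\
     (forall z : R[i], `|z| = 1 -> psdC (Pi_eps eps (Pi A B1 B2 Q z))) /\
     pdC (ulsubmx (Pi A B1 B2 Q z0)) /\ ndC (drsubmx (Pi A B1 B2 Q z0))) ->
  forall a : 'cV[R]_n,
    ((forall w, l2 q w -> g_inf_v A B1 B2 Q a w \is a fin_num) /\
     (forall v, l2 k v -> g_sup_w A B1 B2 Q a v \is a fin_num) /\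
     l2_continuous (fun w => fine (g_inf_v A B1 B2 Q a w)) /\
     l2_continuous (fun v => fine (g_sup_w A B1 B2 Q a v))) /\
    ereal_inf [set g_sup_w A B1 B2 Q a v | v in l2 k] =
    ereal_sup [set g_inf_v A B1 B2 Q a w | w in l2 q].
Proof.
move=> sA sQ [eps [z0 [eps0 [z01 [psd [pd1 nd2]]]]]] a.
have [c H] := gfun_saddle sA sQ eps0 z01 psd pd1 nd2 a.
have PP := @l2_lin_closed R k; have SS := @l2_lin_closed R q.
(* The extrema are bounded in terms of [qa] or [qc]; continuity in the l2 norm needs these in turn
   to be bounded by the squared norm of the input. *)
have output_le m (B : 'M[R]_(n, m)) (E : 'M[R]_(n + (k + q), m)) : exists2 M : R, 0 <= M &
    forall u, l2 m u -> `|l2S Q (output A B (state_out R n k q) E u)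
      (output A B (state_out R n k q) E u)| <= M * l2N u.
  have [d d0 hd] := l2N_output B (state_out R n k q) E sA.
  have q0 := mxabs_gt0 Q; exists (mxabs Q * (2 * d)) => [|u lu].
    by rewrite !mulr_ge0 // ltW.
  have ly := l2_output B (state_out R n k q) E sA lu.
  apply: (le_trans (l2S_le Q (@ltr01 R) ly ly)); rewrite invr1 !mul1r -mulrA ler_pM2l //.
  by have := hd _ lu; lra.
split; last exact: (saddle_minimax H PP SS eps0).
split; first by move=> w lw; have [h _ _] := saddle_infP H PP SS eps0 lw; rewrite /g_inf_v h.
split; first by move=> v lv; have [h _ _] := saddle_supP H PP SS eps0 lv; rewrite /g_sup_w h.
split; last first.
  have [M M0 hM] := output_le k B1 (input1_out R n k q).
  apply: (saddle_sup_continuous (N := @l2N R k) H PP SS eps0 _ _ _ M0) => [s u lu|u v lu lv|u lu|u lu].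
  - exact: l2NZ.
  - exact: l2ND.
  - exact: l2N_ge0.
  - exact: le_trans (ler_norm _) (hM _ lu).
have [M M0 hM] := output_le q B2 (input2_out R n k q).
move=> w0 lw0 e e0.
(* Continuity of the infimum is that of the supremum in the exchanged game, up to a sign that the
   absolute value removes. *)
have [||||d d0 hd] :=
  saddle_sup_continuous (N := @l2N R q) (quadratic_saddle_swap H) SS PP eps0 _ _ _ M0 _ lw0 e0.
- by move=> s u lu; exact: l2NZ.
- by move=> u v lu lv; exact: l2ND.
- by move=> u lu; exact: l2N_ge0.
- by move=> u lu; apply: le_trans (hM _ lu); rewrite -normrN; exact: ler_norm.
exists d => // w lw hw; have := hd w lw hw.
have E u : l2 q u -> fine (g_inf_v A B1 B2 Q a u) =
    - saddle_sup (l2 k) (fun w v => - gfun A B1 B2 Q a v w) u.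
  by move=> lu; exact: (saddle_inf_sup H PP SS eps0 lu).
by rewrite !E // -opprD normrN.
Qed.
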